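(* Assume $\mu>0$ and let $\alpha\ge J(K^* )$. Define $$M=\frac{2\alpha^2}{\mu\,\sigma_{\min}(Q)}\|B\|\|C\|\big((2\zeta_1+\zeta_2)\|B\|\|C\|+2\zeta_3+\zeta_4\big),$$ where the constants $\zeta_1,\zeta_2,\zeta_3,\zeta_4$ (depending on $\alpha$ and the problem data) are those given in the context. Then for any $K,K'\in\mathbb{K}_\alpha$ satisfying $K+\delta(K'-K)\in\mathbb{K}_\alpha$ for all $\delta\in[0,1]$, $$\|\nabla^2J(\mathrm{vec}(K))-\nabla^2J(\mathrm{vec}(K'))\|\le M\|K-K'\|.$$
   Context: Setting: $A\in\mathbb{R}^{n\times n}$, $B\in\mathbb{R}^{n\times m}$, $C\in\mathbb{R}^{d\times n}$ with $C$ of full row rank; $Q\in\mathbb{R}^{n\times n}$ and $R\in\mathbb{R}^{m\times m}$ are symmetric positive definite. The system is $x_{t+1}=Ax_t+Bu_t$, $y_t=Cx_t$, with static output feedback $u_t=-Ky_t$, $K\in\mathbb{R}^{m\times d}$, so that $x_{t+1}=(A-BKC)x_t$. The initial state $x_0$ is drawn from a distribution $\mathcal{D}$ with second-moment matrix $X_0:=\mathbb{E}_{x_0\sim\mathcal{D}}[x_0x_0^\top]\in\mathbb{R}^{n\times n}$, and $\mu:=\sigma_{\min}(X_0)$ is the minimal singular value of $X_0$. The feasible set is $\mathbb{K}=\{K\in\mathbb{R}^{m\times d}:\rho(A-BKC)<1\}$ ($\rho$ = spectral radius), assumed nonempty. For $K\in\mathbb{K}$ the cost is $J(K)=\mathbb{E}_{x_0\sim\mathcal{D}}\big[\sum_{t=0}^\infty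 x_t^\top(Q+C^\top K^\top RKC)x_t\big]$. Equivalently $J(K)=\mathrm{Tr}(P_KX_0)$, where $P_K$ is the solution of $P_K=Q+C^\top K^\top RKC+(A-BKC)^\top P_K(A-BKC)$. $K^*$ is a global minimizer of $J$ over $\mathbb{K}$, and $\mathbb{K}_\alpha=\{K\in\mathbb{K}:J(K)\le\alpha\}$. $\|\cdot\|$ is the spectral norm, $\sigma_{\min}$ the minimal singular value. $\nabla^2J(\mathrm{vec}(K))\in\mathbb{R}^{md\times md}$ is the Hessian of $J$ regarded as a function of the vectorization $\mathrm{vec}(K)$. Constants: $\gamma:=\max_{K\in\mathbb{K}_\alpha}\|A-BKC\|$, $$q_3:=\frac{\sqrt{\|R\|\alpha+\|B\|^2\alpha^2/\mu}}{\sqrt{\mu}\,\sigma_{\min}(R)}+\frac{\|B\|\|A\|\alpha}{\mu\,\sigma_{\min}(R)},$$ $$\zeta_1 = \frac{1}{\sigma_{\min}(Q)}\Big((1+\|C\|^2\|B\|^2)\frac{\alpha}{\mu}+\|C\|^2\|R\|\Big)-1,$$ $$\zeta_2=\frac{2}{\sigma_{\min}(Q)}\Big(\|C\|\|R\|q_3+\gamma\|C\|\|B\|\frac{\alpha}{\mu}\Big),$$ $$\zeta_3=\frac{2}{\sigma_{\min}(Q)}\Big(\|C\|^2\|R\|+\|C\|\|B\|\big(\|C\|\|B\|+\zeta_1\gamma+\zeta_2\gamma\big)\frac{\alpha}{\mu}\Big),$$ $$\zeta_4=\frac{2}{\sigma_{\min}(Q)}\Big(\|C\|^2\|R\|+\|C\|\|B\|\big(\|C\|\|B\|+\zeta_1\gamma\big)\frac{\alpha}{\mu}\Big).$$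 *)

(* Defs.v *)
From HB Require Import structures.
From mathcomp Require Import all_boot all_order all_algebra.
From mathcomp Require Import complex.
From mathcomp Require Import all_classical all_reals all_analysis.

Set Implicit Arguments.
Unset Strict Implicit.
Unset Printing Implicit Defensive.

Import Order.TTheory GRing.Theory Num.Theory.
Import numFieldNormedType.Exports.

Local Open Scope classical_set_scope.
Local Open Scope ring_scope.

Definition posdef (F : realType) n (M : 'M[F]_n) : Prop :=
  M^T = M /\ forall x : 'cV[F]_n, x != 0 -> 0 < (x^T *m M *m x) 0 0.

Definition norm2 (F : realType) n (x : 'cV[F]_n) : F :=
  Num.sqrt (\sum_i x i 0 ^+ 2).

(* The norm that the library puts on matrices is the entrywise max norm, so the
   spectral norm is defined here, as the norm induced by the Euclidean one. *)
Definition spectral_norm (F : realType) m n (M : 'M[F]_(m, n)) : F :=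
  sup [set norm2 (M *m x) | x in [set x : 'cV[F]_n | norm2 x <= 1]].

(* Restricted to square matrices: for a wide M, M^T *m M has eigenvalues 0 that
   do not come from singular values. *)
Definition singular_values (F : realType) n (M : 'M[F]_n) : set F :=
  [set s | 0 <= s /\ eigenvalue (M^T *m M) (s ^+ 2)].

Definition sigma_min (F : realType) n (M : 'M[F]_n) : F :=
  inf (singular_values M).

Definition spectral_radius (F : realType) n (M : 'M[F]_n) : F :=
  sup [set ComplexField.Normc.normc l | l in [set l : F[i] | eigenvalue (map_mx (real_complex F) M) l]].

(* Column-stacking vectorization: mxvec lists a matrix row by row, hence the
   transpositions. *)
Definition vec (F : realType) m d (K : 'M[F]_(m, d)) : 'cV[F]_(d * m) :=
  (mxvec K^T)^T.

Definition unvec (F : realType) m d (v : 'cV[F]_(d * m)) : 'M[F]_(m, d) :=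
  (vec_mx v^T)^T.

Definition hessian (F : realType) p (f : 'cV[F]_p -> F) (v : 'cV[F]_p) : 'M[F]_p :=
  \matrix_(i, j) 'D_(delta_mx i 0) (fun w => 'D_(delta_mx j 0) f w) v.

Definition closed_loop (F : realType) n m d (A : 'M[F]_n) (B : 'M[F]_(n, m))
    (C : 'M[F]_(d, n)) (K : 'M[F]_(m, d)) : 'M[F]_n :=
  A - B *m K *m C.

Definition feasible (F : realType) n m d (A : 'M[F]_n) (B : 'M[F]_(n, m))
    (C : 'M[F]_(d, n)) : set 'M[F]_(m, d) :=
  [set K | spectral_radius (closed_loop A B C K) < 1].

Fixpoint state (F : realType) n m d (A : 'M[F]_n) (B : 'M[F]_(n, m))
    (C : 'M[F]_(d, n)) (K : 'M[F]_(m, d)) (x0 : 'cV[F]_n) (t : nat) : 'cV[F]_n :=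
  match t with
  | 0%N => x0
  | t'.+1 =>
      let x := state A B C K x0 t' in
      let y := C *m x in
      let u := - (K *m y) in
      A *m x + B *m u
  end.

Definition stage_cost (F : realType) n m d (C : 'M[F]_(d, n)) (Q : 'M[F]_n)
    (R : 'M[F]_m) (K : 'M[F]_(m, d)) (x : 'cV[F]_n) : F :=
  (x^T *m (Q + C^T *m K^T *m R *m K *m C) *m x) 0 0.

(* The expectation is taken in the extended reals.  On the feasible set, which is
   the only place where the cost is used, it is finite; fine sends an infinite
   value to 0. *)
Definition cost (F : realType) n m d (A : 'M[F]_n) (B : 'M[F]_(n, m))
    (C : 'M[F]_(d, n)) (Q : 'M[F]_n) (R : 'M[F]_m) (disp : measure_display)
    (T : measurableType disp) (P : probability T F) (x0 : T -> 'cV[F]_n)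
    (K : 'M[F]_(m, d)) : F :=
  fine (\int[P]_w (\sum_(0 <= t <oo)
          (stage_cost C Q R K (state A B C K (x0 w) t))%:E))%E.

(* A random vector with finite second moments. *)
Definition square_integrable (F : realType) n (disp : measure_display)
    (T : measurableType disp) (P : probability T F) (x0 : T -> 'cV[F]_n) : Prop :=
  (forall i, measurable_fun setT (fun w => x0 w i 0)) /\
  (forall i j, P.-integrable setT (fun w => (x0 w i 0 * x0 w j 0)%:E)).

Definition second_moment (F : realType) n (disp : measure_display)
    (T : measurableType disp) (P : probability T F) (x0 : T -> 'cV[F]_n) : 'M[F]_n :=
  \matrix_(i, j) fine 'E_P[(fun w => x0 w i 0 * x0 w j 0)].

Definition sublevel (F : realType) n m d (A : 'M[F]_n) (B : 'M[F]_(n, m))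
    (C : 'M[F]_(d, n)) (J : 'M[F]_(m, d) -> F) (alpha : F) : set 'M[F]_(m, d) :=
  [set K | feasible A B C K /\ J K <= alpha].

(* The maximum over the sublevel set, written as a supremum. *)
Definition gamma_cst (F : realType) n m d (A : 'M[F]_n) (B : 'M[F]_(n, m))
    (C : 'M[F]_(d, n)) (J : 'M[F]_(m, d) -> F) (alpha : F) : F :=
  sup [set spectral_norm (closed_loop A B C K) | K in sublevel A B C J alpha].

Section constants.
Context (F : realType) (n m d : nat).
Variables (A : 'M[F]_n) (B : 'M[F]_(n, m)) (C : 'M[F]_(d, n)).
Variables (Q : 'M[F]_n) (R : 'M[F]_m).
Variables (alpha mu gamma : F).

Local Notation nA := (spectral_norm A).
Local Notation nB := (spectral_norm B).
Local Notation nC := (spectral_norm C).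
Local Notation nR := (spectral_norm R).
Local Notation sQ := (sigma_min Q).
Local Notation sR := (sigma_min R).

Definition q3 : F :=
  Num.sqrt (nR * alpha + nB ^+ 2 * alpha ^+ 2 / mu) / (Num.sqrt mu * sR)
  + nB * nA * alpha / (mu * sR).

Definition zeta1 : F :=
  sQ^-1 * ((1 + nC ^+ 2 * nB ^+ 2) * (alpha / mu) + nC ^+ 2 * nR) - 1.

Definition zeta2 : F :=
  2 / sQ * (nC * nR * q3 + gamma * nC * nB * (alpha / mu)).

Definition zeta3 : F :=
  2 / sQ * (nC ^+ 2 * nR
    + nC * nB * (nC * nB + zeta1 * gamma + zeta2 * gamma) * (alpha / mu)).

Definition zeta4 : F :=
  2 / sQ * (nC ^+ 2 * nR
    + nC * nB * (nC * nB + zeta1 * gamma) * (alpha / mu)).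

Definition hessian_lipschitz_cst : F :=
  2 * alpha ^+ 2 / (mu * sQ) * nB * nC
  * ((2 * zeta1 + zeta2) * nB * nC + 2 * zeta3 + zeta4).

End constants.

(* Main.v *)
Require Import Defs.
From mathcomp Require Import all_boot all_order all_algebra.
From mathcomp Require Import complex.
From mathcomp Require Import all_classical all_reals all_analysis.
From mathcomp Require Import ring lra.
Import Order.TTheory GRing.Theory Num.Theory.
Import numFieldNormedType.Exports.
Set Implicit Arguments.
Unset Strict Implicit.
Unset Printing Implicit Defensive.
Local Open Scope classical_set_scope.
Local Open Scope ring_scope.

(** Let [AK = A - B *m K *m C] be the closed loop of a stabilizing gain [K].  The
    cost of [K] is the trace of [P_K *m X0], where [X0] is the second moment of
    the initial state and [P_K] solves the Stein equation
    [X = W + AK^T *m X *m AK] with [W = Q + (K *m C)^T *m R *m (K *m C)]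
    ([cost_trace]).  Differentiating this equation in [K], one finds that each
    derivative of [P_K] solves the same equation with another right-hand side
    ([mderiv_lyap], [mderiv_cost_matrix], [mderiv_dcost1], [mderiv_dcost2]).  So
    the Hessian is the trace of the second derivative against [X0], and by the
    mean value theorem its variation along a segment is controlled by the trace
    of the third derivative ([hessian_lipschitz_segment]).

    The estimates rest on one principle: the operator [lyap AK] that solves the
    Stein equation is monotone for the order of quadratic forms
    ([lyap_norm_le]).  Hence a bound of a right-hand side by a multiple of [W]
    bounds the solution by the same multiple of [P_K].  On the sublevel set
    [P_K <= alpha / mu], because [X0 >= mu] ([moment_lower]).

    The first derivative of [P_K] in a unit direction is at most [zeta1 * P_K]
    ([rhs1_bound1]) and also at most [2 / 3 * zeta2 * P_K] ([rhs1_bound2]).  Let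
    [z] be the smaller of the two factors.  In the second derivative the feedback
    terms contribute [2 * z * gamma], in the third derivative there are three
    such contributions, [6 * z * gamma] in total.  The constant of the theorem
    contains [(3 * zeta1 + 2 * zeta2) * gamma] at this place, as [zeta4] has a
    single [zeta1 * gamma].  From [z <= zeta1] and [z <= zeta2] one contribution
    would be left over; the factor [2 / 3] absorbs it ([sens3_le]).

    Two facts give the differential calculus its ground.  A spectral radius less
    than [1] makes the powers of the matrix decay ([stable_decay]), which gives
    existence, uniqueness and the series of the solution of the Stein equation.
    Conversely, a Lyapunov form that decreases strictly forces the spectral
    radius below [1] ([lyapunov_stable]); as the decrease is stable under
    perturbation, stabilizing gains form an open set and [lyap] is continuous
    ([stable_near], [lyap_mcvg0]). *)

(** * Bilinear and quadratic forms of matrices *)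

Section Forms.
Variable F : realType.

Definition bform n (M : 'M[F]_n) (x y : 'cV[F]_n) : F := (x^T *m M *m y) 0 0.

Definition qform n (M : 'M[F]_n) (x : 'cV[F]_n) : F := bform M x x.

Definition symmx n (M : 'M[F]_n) : 'M[F]_n := M + M^T.

Definition sqnorm n (x : 'cV[F]_n) : F := \sum_i x i 0 ^+ 2.

Definition psd n (M : 'M[F]_n) : Prop := M^T = M /\ forall x, 0 <= qform M x.

Lemma bformE n (M : 'M[F]_n) x y :
  bform M x y = \sum_i \sum_j x i 0 * M i j * y j 0.
Proof.
rewrite /bform mxE exchange_big /=; apply: eq_bigr => j _.
rewrite mxE big_distrl /=; apply: eq_bigr => i _.
by rewrite !mxE.
Qed.

Lemma bformDm n (M N : 'M[F]_n) x y : bform (M + N) x y = bform M x y + bform N x y.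
Proof. by rewrite /bform mulmxDr mulmxDl mxE. Qed.

Lemma bformNm n (M : 'M[F]_n) x y : bform (- M) x y = - bform M x y.
Proof. by rewrite /bform mulmxN mulNmx mxE. Qed.

Lemma bformBm n (M N : 'M[F]_n) x y : bform (M - N) x y = bform M x y - bform N x y.
Proof. by rewrite bformDm bformNm. Qed.

Lemma bformZm n a (M : 'M[F]_n) x y : bform (a *: M) x y = a * bform M x y.
Proof. by rewrite /bform -scalemxAr -scalemxAl mxE. Qed.

Lemma bformDl n (M : 'M[F]_n) x y z : bform M (x + y) z = bform M x z + bform M y z.
Proof. by rewrite /bform linearD /= !mulmxDl mxE. Qed.

Lemma bformDr n (M : 'M[F]_n) x y z : bform M x (y + z) = bform M x y + bform M x z.
Proof. by rewrite /bform mulmxDr mxE. Qed.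

Lemma bformZl n a (M : 'M[F]_n) x y : bform M (a *: x) y = a * bform M x y.
Proof. by rewrite /bform linearZ /= -!scalemxAl mxE. Qed.

Lemma bformZr n a (M : 'M[F]_n) x y : bform M x (a *: y) = a * bform M x y.
Proof. by rewrite /bform -!scalemxAr mxE. Qed.

Lemma bformT n (M : 'M[F]_n) x y : bform M^T x y = bform M y x.
Proof.
rewrite /bform.
have <- : ((x^T *m M^T *m y)^T) 0 0 = (x^T *m M^T *m y) 0 0 by rewrite mxE.
by rewrite !trmx_mul !trmxK mulmxA.
Qed.

Lemma bform_congr n p (M : 'M[F]_n) (N : 'M[F]_(n, p)) x y :
  bform (N^T *m M *m N) x y = bform M (N *m x) (N *m y).
Proof. by rewrite /bform trmx_mul !mulmxA. Qed.

Lemma qform_mul n p (M : 'M[F]_n) (U V : 'M[F]_(n, p)) x :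
  qform (U^T *m M *m V) x = bform M (U *m x) (V *m x).
Proof. by rewrite /qform /bform trmx_mul !mulmxA. Qed.

Lemma qform_symmx n (M : 'M[F]_n) x : qform (symmx M) x = 2 * qform M x.
Proof. by rewrite /qform /symmx bformDm bformT mulr_natl mulr2n. Qed.

Lemma symmx_sym n (M : 'M[F]_n) : (symmx M)^T = symmx M.
Proof. by rewrite /symmx linearD /= trmxK addrC. Qed.

Lemma qformDm n (M N : 'M[F]_n) x : qform (M + N) x = qform M x + qform N x.
Proof. exact: bformDm. Qed.

Lemma qformBm n (M N : 'M[F]_n) x : qform (M - N) x = qform M x - qform N x.
Proof. exact: bformBm. Qed.

Lemma qformZm n a (M : 'M[F]_n) x : qform (a *: M) x = a * qform M x.
Proof. exact: bformZm. Qed.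

Lemma qformZ n a (M : 'M[F]_n) x : qform M (a *: x) = a ^+ 2 * qform M x.
Proof. by rewrite /qform bformZl bformZr mulrA expr2. Qed.

Lemma qform1 n (x : 'cV[F]_n) : qform 1%:M x = sqnorm x.
Proof.
rewrite /qform /bform mulmx1 mxE; apply: eq_bigr => i _.
by rewrite mxE expr2.
Qed.

Lemma sqnorm_ge0 n (x : 'cV[F]_n) : 0 <= sqnorm x.
Proof. by apply: sumr_ge0 => i _; exact: sqr_ge0. Qed.

Lemma sqnorm_eq0 n (x : 'cV[F]_n) : sqnorm x = 0 -> x = 0.
Proof.
move=> /eqP; rewrite /sqnorm psumr_eq0; last by move=> i _; exact: sqr_ge0.
move=> /allP h; apply/matrixP => i j; rewrite ord1 mxE.
by have := h i (mem_index_enum _); rewrite /= sqrf_eq0 => /eqP.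
Qed.

Lemma sqnorm_gt0 n (x : 'cV[F]_n) : x != 0 -> 0 < sqnorm x.
Proof.
move=> x0; rewrite lt_def sqnorm_ge0 andbT.
by apply: contra x0 => /eqP/sqnorm_eq0/eqP.
Qed.

Lemma norm2E n (x : 'cV[F]_n) : norm2 x ^+ 2 = sqnorm x.
Proof. by rewrite sqr_sqrtr ?sqnorm_ge0. Qed.

Lemma norm2_ge0 n (x : 'cV[F]_n) : 0 <= norm2 x.
Proof. exact: sqrtr_ge0. Qed.

Lemma norm2_eq0 n (x : 'cV[F]_n) : norm2 x = 0 -> x = 0.
Proof. by move=> x0; apply: sqnorm_eq0; rewrite -norm2E x0 expr0n. Qed.

Lemma norm2Z n a (x : 'cV[F]_n) : norm2 (a *: x) = `|a| * norm2 x.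
Proof.
rewrite /norm2 -sqrtr_sqr -sqrtrM ?sqr_ge0// mulr_sumr.
by congr Num.sqrt; apply: eq_bigr => i _; rewrite mxE exprMn.
Qed.

Lemma norm20 n : norm2 (0 : 'cV[F]_n) = 0.
Proof. by rewrite -(scale0r (0 : 'cV_n)) norm2Z normr0 mul0r. Qed.

(** Both [qform V (t *: x + y)] and [qform V (t *: x - y)] are nonnegative;
    expanding them bounds the cross term from either side. *)
Lemma bform_young n (V : 'M[F]_n) x y (t : F) : psd V -> 0 < t ->
  2 * `|bform V x y| <= t * qform V x + t^-1 * qform V y.
Proof.
move=> [Vs V0] t0.
have e (s : F) : s ^+ 2 = 1 ->
   t^-1 * qform V (t *: x + s *: y) =
   t * qform V x + t^-1 * qform V y + 2 * s * bform V x y.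
  move=> s2; rewrite /qform !bformDl !bformDr !bformZl !bformZr.
  have -> : bform V y x = bform V x y by rewrite -bformT Vs.
  transitivity (t * bform V x x + s ^+ 2 * t^-1 * bform V y y +
    2 * s * bform V x y).
    by field; rewrite gt_eqF.
  by rewrite s2 mul1r.
have h s : 0 <= t^-1 * qform V (t *: x + s *: y).
  by rewrite mulr_ge0 ?V0// invr_ge0 ltW.
have := h 1; rewrite e ?expr1n// => h1.
have := h (-1); rewrite e ?sqrrN ?expr1n// => h2.
move: h1 h2; set p := t * _; set q := t^-1 * _ => h1 h2.
by case: (ger0P (bform V x y)) => _; lra.
Qed.

Lemma bform_CS n (V : 'M[F]_n) x y : psd V ->
  bform V x y ^+ 2 <= qform V x * qform V y.
Proof.
move=> pV; have [Vs V0] := pV.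
set b := bform V x y; set p := qform V x; set q := qform V y.
have p0 : 0 <= p by exact: V0.
have q0 : 0 <= q by exact: V0.
have h t : 0 < t -> 2 * t * `|b| <= t ^+ 2 * p + q.
  move=> t0; have := bform_young x y pV t0; rewrite -/b -/p -/q => h.
  have -> : t ^+ 2 * p + q = t * (t * p + t^-1 * q) by field; rewrite gt_eqF.
  by rewrite -mulrA mulrCA ler_wpM2l// ltW.
have b0 : 0 <= `|b| by [].
rewrite -real_normK ?num_real//; set c := `|b| in h b0 *.
have [/eqP c0|cn0] := boolP (c == 0); first by rewrite c0 expr0n/= mulr_ge0.
have c1 : 0 < c by rewrite lt_def cn0.
have [/eqP pz|pn0] := boolP (p == 0).
  have qc : 0 < (q + 1) / c by rewrite divr_gt0// ltr_wpDl.
  have := h _ qc; rewrite pz mulr0 add0r.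
  have -> : 2 * ((q + 1) / c) * c = 2 * q + 2 by field; rewrite gt_eqF.
  lra.
have p1 : 0 < p by rewrite lt_def pn0.
have := h _ (divr_gt0 c1 p1).
have -> : 2 * (c / p) * c = 2 * (c ^+ 2 / p) by field; rewrite gt_eqF.
have -> : (c / p) ^+ 2 * p = c ^+ 2 / p by field; rewrite gt_eqF.
move=> h1; have : c ^+ 2 / p <= q by lra.
by rewrite ler_pdivrMr// mulrC.
Qed.

(** Polarization writes [4 * bform N x y] as a difference of two values of
    [qform N]; the parallelogram law adds up their bounds. *)
Lemma bform_dom n (N V : 'M[F]_n) x y : N^T = N ->
  (forall z, `|qform N z| <= qform V z) ->
  2 * `|bform N x y| <= qform V x + qform V y.
Proof.
move=> Ns h.
have e : 4 * bform N x y = qform N (x + y) - qform N (x + -1 *: y).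
  rewrite /qform !bformDl !bformDr !bformZl !bformZr.
  have -> : bform N y x = bform N x y by rewrite -bformT Ns.
  ring.
have eV : qform V (x + y) + qform V (x + -1 *: y) = 2 * (qform V x + qform V y).
  rewrite /qform !bformDl !bformDr !bformZl !bformZr; ring.
have := h (x + y); have := h (x + -1 *: y).
rewrite !ler_norml => /andP[h1 h2] /andP[h3 h4].
by case: (ger0P (bform N x y)) => _; lra.
Qed.

Lemma psd1 n : psd (1%:M : 'M[F]_n).
Proof. by split=> [|x]; rewrite ?trmx1// qform1 sqnorm_ge0. Qed.

(** Rescaling [x] and [y] to unit vectors makes [bform_dom] homogeneous. *)
Lemma bform_bound n (N : 'M[F]_n) k x y : N^T = N ->
  (forall z, `|qform N z| <= k * sqnorm z) ->
  `|bform N x y| <= k * (norm2 x * norm2 y).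
Proof.
move=> Ns h.
have [/eqP x0|x0] := boolP (norm2 x == 0).
  by rewrite x0 mul0r mulr0 (norm2_eq0 x0) -(scale0r 0) bformZl mul0r normr0.
have [/eqP y0|y0] := boolP (norm2 y == 0).
  by rewrite y0 !mulr0 (norm2_eq0 y0) -(scale0r 0) bformZr mul0r normr0.
have x1 : 0 < norm2 x by rewrite lt_def x0 norm2_ge0.
have y1 : 0 < norm2 y by rewrite lt_def y0 norm2_ge0.
have h' z : `|qform N z| <= qform (k *: 1%:M) z by rewrite qformZm qform1.
have := bform_dom ((norm2 x)^-1 *: x) ((norm2 y)^-1 *: y) Ns h'.
rewrite !qformZ !qformZm !qform1 bformZl bformZr -!norm2E !normrM.
rewrite !(@gtr0_norm _ (_^-1)) ?invr_gt0//.
set a := norm2 x; set b := norm2 y; set c := `|_|.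
have -> : a^-1 ^+ 2 * (k * a ^+ 2) + b^-1 ^+ 2 * (k * b ^+ 2) = 2 * k.
  by field; rewrite !gt_eqF.
rewrite ler_pM2l// mulrA -invfM mulrC ler_pdivrMr ?mulr_gt0//.
Qed.

Lemma dot_CS n (x y : 'cV[F]_n) : `|(x^T *m y) 0 0| <= norm2 x * norm2 y.
Proof.
have <- : bform 1%:M x y = (x^T *m y) 0 0 by rewrite /bform mulmx1.
rewrite -[leRHS]mul1r; apply: bform_bound; first exact: trmx1.
by move=> z; rewrite qform1 mul1r ger0_norm// sqnorm_ge0.
Qed.

(** Cauchy-Schwarz between [N *m v] and [v]. *)
Lemma psd_ker n (N : 'M[F]_n) v : psd N -> qform N v = 0 -> N *m v = 0.
Proof.
move=> pN v0; apply: sqnorm_eq0; set w := N *m v.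
have := bform_CS w v pN; rewrite v0 mulr0.
have -> : bform N w v = sqnorm w.
  by rewrite -qform1 /qform /bform mulmx1 -mulmxA.
move=> h; apply/eqP; rewrite -sqrf_eq0.
by apply/eqP/le_anti; rewrite h sqr_ge0.
Qed.

(** This lemma and [qform_entry] exchange bounds on quadratic forms, in which
    the estimates are stated, and entrywise bounds, in which limits are. *)
Lemma norm_entry n (M : 'M[F]_n) e : M^T = M ->
  (forall x, `|qform M x| <= e * sqnorm x) -> forall i j, `|M i j| <= e.
Proof.
move=> Ms h i j.
have := bform_bound (delta_mx i 0) (delta_mx j 0) Ms h.
have n1 (k : 'I_n) : norm2 (delta_mx k 0 : 'cV[F]_n) = 1.
  rewrite /norm2 (bigD1 k)//= big1.
    by rewrite mxE !eqxx addr0 expr1n sqrtr1.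
  by move=> l lk; rewrite mxE (negbTE lk) /= expr0n.
rewrite !n1 mulr1 mulr1.
by rewrite /bform trmx_delta -rowE -colE !mxE.
Qed.

Lemma qform_entry n (M : 'M[F]_n) e x : (forall i j, `|M i j| <= e) ->
  `|qform M x| <= e * n%:R * sqnorm x.
Proof.
move=> h; rewrite /qform bformE.
apply: le_trans (ler_norm_sum _ _ _) _.
apply: (@le_trans _ _ (\sum_i \sum_j (e / 2 * (x i 0 ^+ 2 + x j 0 ^+ 2)))).
  apply: ler_sum => i _; apply: le_trans (ler_norm_sum _ _ _) _.
  apply: ler_sum => j _; rewrite !normrM.
  have hij := h i j; set a := `|x i 0|; set b := `|x j 0|.
  have ab : a * b <= (x i 0 ^+ 2 + x j 0 ^+ 2) / 2.
    rewrite -(real_normK (num_real (x i 0))) -(real_normK (num_real (x j 0))).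
    by have := sqr_ge0 (a - b); rewrite /a /b; nra.
  rewrite mulrAC.
  have ab0 : 0 <= a * b by rewrite /a /b mulr_ge0.
  have e0 : 0 <= e by exact: le_trans hij.
  apply: (@le_trans _ _ (a * b * e)); first by apply: ler_wpM2l.
  by have := ler_wpM2r e0 ab; lra.
have -> : \sum_i \sum_j e / 2 * (x i 0 ^+ 2 + x j 0 ^+ 2) =
   e / 2 * (\sum_i \sum_j (x i 0 ^+ 2 + x j 0 ^+ 2)).
  by rewrite mulr_sumr; apply: eq_bigr => i _; rewrite mulr_sumr.
have -> : \sum_i \sum_j (x i 0 ^+ 2 + x j 0 ^+ 2) = n%:R * sqnorm x + n%:R * sqnorm x.
  under eq_bigr do rewrite big_split /= sumr_const card_ord.
  by rewrite big_split /= sumr_const card_ord sumrMnl !mulr_natl.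
by rewrite le_eqVlt; apply/orP; left; apply/eqP; field.
Qed.

Lemma qform_bounded n (M : 'M[F]_n) :
  exists2 k, 0 < k & forall x, `|qform M x| <= k * sqnorm x.
Proof.
pose b := \sum_i \sum_j `|M i j|.
have b0 : 0 <= b by do 2!apply: sumr_ge0 => ? _.
exists (b * n%:R + 1); first by rewrite ltr_wpDl// mulr_ge0.
move=> x; apply: le_trans (qform_entry (e := b) x _) _; last first.
  by rewrite ler_wpM2r ?sqnorm_ge0// lerDl.
move=> i j; rewrite /b (bigD1 i)//= (bigD1 j)//= -addrA lerDl addr_ge0//.
  by apply: sumr_ge0.
by do 2!apply: sumr_ge0 => ? _.
Qed.

End Forms.

(** * Spectral norm and smallest singular value *)

Section SpectralNorm.
Variable F : realType.

Definition frobenius p q (M : 'M[F]_(p, q)) : F :=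
  Num.sqrt (\sum_i \sum_j M i j ^+ 2).

Lemma norm2_frobenius p q (M : 'M[F]_(p, q)) x :
  norm2 (M *m x) <= frobenius M * norm2 x.
Proof.
rewrite /norm2 -sqrtrM; last first.
  by apply: sumr_ge0 => i _; apply: sumr_ge0 => j _; exact: sqr_ge0.
rewrite ler_sqrt; last first.
  apply: mulr_ge0; last exact: sqnorm_ge0.
  by apply: sumr_ge0 => i _; apply: sumr_ge0 => j _; exact: sqr_ge0.
rewrite mulr_suml; apply: ler_sum => i _.
have -> : (M *m x) i 0 = ((row i M)^T^T *m x) 0 0.
  by rewrite trmxK !mxE; apply: eq_bigr => j _; rewrite mxE.
rewrite -real_normK ?num_real//.
apply: le_trans (_ : (norm2 (row i M)^T * norm2 x) ^+ 2 <= _).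
  by rewrite lerXn2r ?nnegrE ?mulr_ge0 ?norm2_ge0// dot_CS.
rewrite exprMn !norm2E /sqnorm le_eqVlt; apply/orP; left; apply/eqP.
by congr (_ * _); apply: eq_bigr => j _; rewrite !mxE.
Qed.

Lemma spectral_norm_has_ub p q (M : 'M[F]_(p, q)) :
  has_ubound [set norm2 (M *m x) | x in [set x : 'cV[F]_q | norm2 x <= 1]].
Proof.
exists (frobenius M) => _ [x /= x1 <-]; apply: le_trans (norm2_frobenius _ _) _.
by rewrite ler_piMr// sqrtr_ge0.
Qed.

Lemma spectral_norm_ge0 p q (M : 'M[F]_(p, q)) : 0 <= spectral_norm M.
Proof.
apply: ub_le_sup; first exact: spectral_norm_has_ub.
by exists 0 => /=; rewrite ?mulmx0 norm20.
Qed.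

Lemma norm2_mul p q (M : 'M[F]_(p, q)) x :
  norm2 (M *m x) <= spectral_norm M * norm2 x.
Proof.
have [/eqP x0|x0] := boolP (norm2 x == 0).
  by rewrite x0 mulr0 (norm2_eq0 x0) mulmx0 norm20.
have x1 : 0 < norm2 x by rewrite lt_def x0 norm2_ge0.
rewrite -ler_pdivrMr//.
have -> : norm2 (M *m x) / norm2 x = norm2 (M *m ((norm2 x)^-1 *: x)).
  by rewrite -scalemxAr norm2Z gtr0_norm ?invr_gt0// mulrC.
apply: ub_le_sup; first exact: spectral_norm_has_ub.
exists ((norm2 x)^-1 *: x) => //=.
by rewrite norm2Z gtr0_norm ?invr_gt0// mulVf.
Qed.

Lemma spectral_norm_le p q (M : 'M[F]_(p, q)) k :
  0 <= k -> (forall x, norm2 (M *m x) <= k * norm2 x) -> spectral_norm M <= k.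
Proof.
move=> k0 h; apply: ge_sup.
  by exists (norm2 (M *m 0)); exists 0 => //=; rewrite norm20.
by move=> _ [x /= x1 <-]; apply: le_trans (h x) _; rewrite ler_piMr.
Qed.

(** The form at [M *m x] and [x] is the square of the norm of [M *m x]. *)
Lemma spectral_norm_bform p (M : 'M[F]_p) k : 0 <= k ->
  (forall x y, `|bform M x y| <= k * (norm2 x * norm2 y)) -> spectral_norm M <= k.
Proof.
move=> k0 h; apply: spectral_norm_le => // x.
have := h (M *m x) x; set w := M *m x.
have -> : bform M w x = norm2 w ^+ 2.
  by rewrite norm2E -qform1 /qform /bform mulmx1 -mulmxA.
rewrite ger0_norm ?sqr_ge0// mulrCA expr2.
have [->|w0] := eqVneq (norm2 w) 0.
  by rewrite mulr_ge0 ?norm2_ge0.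
by rewrite ler_pM2l// lt_def w0 norm2_ge0.
Qed.

(** The spectral norm is at most the Frobenius norm, which vectorization turns
    into the Euclidean one. *)
Lemma norm2_unvec p q (v : 'cV[F]_(q * p)) (x : 'cV[F]_q) :
  norm2 ((unvec v : 'M[F]_(p, q)) *m x) <= norm2 v * norm2 x.
Proof.
apply: le_trans (norm2_frobenius _ _) _.
rewrite ler_wpM2r ?norm2_ge0// le_eqVlt; apply/orP; left; apply/eqP.
rewrite /frobenius /norm2; congr Num.sqrt.
rewrite (reindex _ (curry_mxvec_bij _ _)) /= exchange_big /= pair_big /=.
by apply: eq_bigr => -[i j] _ /=; rewrite !mxE.
Qed.

End SpectralNorm.

Section SmallestEigenvalue.
Variable F : realType.

Lemma cvg_sum (I : finType) (T : Type) (G : set_system T) {FG : Filter G}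
    (f : I -> T -> F) (l : I -> F) :
  (forall i, f i t @[t --> G] --> l i) ->
  \sum_i f i t @[t --> G] --> \sum_i l i.
Proof. by move=> h; apply: cvg_big => //; exact: add_continuous. Qed.

Lemma cvg_sum0 (I : finType) (T : Type) (G : set_system T) {FG : Filter G}
    (f : I -> T -> F) :
  (forall i, f i t @[t --> G] --> (0 : F)) ->
  \sum_i f i t @[t --> G] --> (0 : F).
Proof. by move=> /cvg_sum; rewrite big1. Qed.

(** The minimum of a quadratic form on the unit sphere, which exists by
    compactness, is an eigenvalue: subtracting it leaves a psd form that
    vanishes at the minimizer. *)
Lemma min_eigenvector n (M : 'M[F]_n.+1) : M^T = M ->
  exists l (v : 'cV[F]_n.+1), [/\ v != 0, M *m v = l *: v & forall x, l * sqnorm x <= qform M x].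
Proof.
move=> Ms.
pose f (x : 'rV[F]_n.+1) := \sum_i \sum_j x 0 i * M i j * x 0 j.
have fE x : f x = qform M x^T.
  rewrite /qform bformE; apply: eq_bigr => i _; apply: eq_bigr => j _.
  by rewrite !mxE.
pose g (x : 'rV[F]_n.+1) := \sum_i x 0 i * x 0 i.
have gE x : g x = sqnorm x^T.
  by apply: eq_bigr => i _; rewrite !mxE expr2.
have cg : continuous g.
  move=> x; apply: (@cvg_sum _ _ (nbhs x)) => i; apply: cvgM; exact: coord_continuous.
have cf : continuous f.
  move=> x; apply: (@cvg_sum _ _ (nbhs x)) => i; apply: (@cvg_sum _ _ (nbhs x)) => j.
  apply: cvgM; last exact: coord_continuous.
  apply: cvgM; first exact: coord_continuous.
  exact: cvg_cst.
pose S := [set x : 'rV[F]_n.+1 | g x = 1].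
have cS : compact S.
  apply: bounded_closed_compact.
    exists 1; split; first exact: num_real.
    move=> y y1 x Sx; apply: le_trans (ltW y1).
    rewrite /Num.norm/= mx_normrE; apply/bigmax_leP; split=> // -[i j] _ /=.
    rewrite ord1 -(@expr_le1 _ 2)// real_normK ?num_real//.
    rewrite -Sx /g (bigD1 j)//= -expr2 lerDl.
    by apply: sumr_ge0 => k _; rewrite -expr2 sqr_ge0.
  apply: (@preimage_closed _ _ g [set x : F | x = 1]).
    by move=> y _; exact: cg.
  exact: (@closed_eq _ (1 : F)).
have S0 : S !=set0.
  exists (delta_mx 0 0); rewrite /S /= gE /sqnorm (bigD1 0)//= big1.
    by rewrite !mxE !eqxx addr0 expr1n.
  by move=> i i0; rewrite !mxE (negbTE i0) andbF expr0n.
have [c cS' fc] := EVT_min_rV S0 cS (continuous_subspaceT cf).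
rewrite inE /S /= in cS'.
have h x : f c * sqnorm x <= qform M x.
  have [->|x0] := eqVneq x 0.
    by rewrite /sqnorm big1 ?mulr0 ?/qform/bform ?mulmx0 ?mxE// => i _; rewrite mxE expr0n.
  have xp : 0 < sqnorm x by exact: sqnorm_gt0.
  have x1 : 0 < norm2 x by rewrite sqrtr_gt0.
  have : f c <= f ((norm2 x)^-1 *: x)^T.
    apply: fc; rewrite inE /S /= gE trmxK -qform1 qformZ qform1 -norm2E exprVn.
    by rewrite mulVf// expf_neq0// gt_eqF.
  rewrite [leRHS]fE trmxK qformZ exprVn norm2E mulrC => hh.
  by rewrite -ler_pdivlMr.
exists (f c), c^T; split => //.
  apply/eqP => c0; move: cS'; rewrite gE c0 /sqnorm big1 => [|i _].
    by move=> /eqP; rewrite eq_sym oner_eq0.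
  by rewrite mxE expr0n.
have pN : psd (M - f c *: 1%:M).
  split; first by rewrite linearB /= linearZ /= trmx1 Ms.
  by move=> x; rewrite qformBm qformZm qform1 subr_ge0.
have := @psd_ker _ _ _ c^T pN; rewrite qformBm qformZm qform1 -gE -fE cS' mulr1 subrr.
move=> /(_ erefl) /eqP; rewrite mulmxBl subr_eq0 => /eqP ->.
by rewrite -scalemxAl mul1mx.
Qed.

(** For a psd matrix the smallest singular value is the smallest eigenvalue [l]:
    a singular vector [u] for [s] satisfies
    [l * |u|^2 <= u^T M u <= |M u| * |u| = s * |u|^2]. *)
Lemma sigma_min_eigen n (M : 'M[F]_n.+1) : psd M ->
  (forall x, sigma_min M * sqnorm x <= qform M x) /\
  exists2 v : 'cV[F]_n.+1, v != 0 & M *m v = sigma_min M *: v.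
Proof.
move=> [Ms M0]; have [l [v [v0 Mv h]]] := min_eigenvector Ms.
have vp := sqnorm_gt0 v0.
have qv : qform M v = l * sqnorm v.
  by rewrite /qform /bform -mulmxA Mv -scalemxAr mxE -qform1 /qform /bform mulmx1.
have l0 : 0 <= l by rewrite -(pmulr_lge0 _ vp) -qv.
have lS : singular_values M l.
  split=> //; apply/eigenvalueP; exists v^T; last by rewrite -(inj_eq trmx_inj) trmxK trmx0.
  rewrite Ms -{1}Ms mulmxA -trmx_mul Mv linearZ /= -scalemxAl -{1}Ms -trmx_mul Mv.
  by rewrite linearZ /= scalerA expr2.
have lb s : singular_values M s -> l <= s.
  move=> [s0 /eigenvalueP[u Mu u0]].
  have u1 : u^T != 0 by rewrite -(inj_eq trmx_inj) trmxK trmx0.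
  have up := sqnorm_gt0 u1.
  have e : sqnorm (M *m u^T) = s ^+ 2 * sqnorm u^T.
    rewrite -!qform1; transitivity (qform (M^T *m 1%:M *m M) u^T).
      by rewrite qform_mul.
    by rewrite /qform /bform !mulmx1 trmxK Mu -scalemxAl mxE.
  have n1 : norm2 (M *m u^T) = s * norm2 u^T.
    by rewrite {1}/norm2 -/(sqnorm _) e sqrtrM ?sqr_ge0// sqrtr_sqr ger0_norm.
  have := dot_CS u^T (M *m u^T); rewrite n1.
  have -> : (u^T^T *m (M *m u^T)) 0 0 = qform M u^T by rewrite mulmxA.
  have := h u^T => h1 h2; have := le_trans h1 (le_trans (ler_norm _) h2).
  by rewrite mulrCA -expr2 norm2E ler_pM2r.
have -> : sigma_min M = l.
  apply/le_anti/andP; split.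
    by apply: ge_inf => //; exists 0 => s [].
  by apply: lb_le_inf; [exists l|move=> s; exact: lb].
by split=> //; exists v.
Qed.

End SmallestEigenvalue.

(** * Spectral radius, decay of powers and Lyapunov's criterion *)

Section Stability.
Variable F : realType.
Local Notation normc := ComplexField.Normc.normc.

Lemma normc_ge0 (z : F[i]) : 0 <= normc z.
Proof. by case: z => a b; exact: sqrtr_ge0. Qed.

Lemma normc_real (a : F) : normc (real_complex F a) = `|a|.
Proof. by rewrite /= expr0n addr0 sqrtr_sqr. Qed.

(** Peeling off one linear factor of an annihilating polynomial at a time: the
    entries of [N * M ^+ t] satisfy a scalar recurrence of ratio [z] whose
    inhomogeneous part [N * (M - z%:M) * M ^+ t] is already known to decay. *)
Lemma annihilator_decay n (M : 'M[F[i]]_n.+1) (s : seq F[i]) (rho r : F) :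
  0 <= rho -> rho < r -> (forall z, z \in s -> normc z <= rho) ->
  forall N : 'M[F[i]]_n.+1, N * \prod_(z <- s) (M - z%:M) = 0 ->
  exists c : F, forall t i j, normc ((N * M ^+ t) i j) <= c * r ^+ t.
Proof.
move=> rho0 rhor; elim: s => [|z s IH] hs N.
  rewrite big_nil mulr1 => ->; exists 0 => t i j.
  by rewrite mul0r mxE mul0r ComplexField.Normc.normc0.
rewrite big_cons mulrA => /IH[|c hc].
  by move=> y ys; apply: hs; rewrite inE ys orbT.
pose b := \sum_i \sum_j normc (N i j).
have hb i j : normc (N i j) <= b.
  rewrite /b (bigD1 i)//= (bigD1 j)//= -addrA lerDl addr_ge0//.
    by apply: sumr_ge0 => *; exact: normc_ge0.
  by do 2!apply: sumr_ge0 => ? _; exact: normc_ge0.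
have b0 : 0 <= b by do 2!apply: sumr_ge0 => ? _; exact: normc_ge0.
have rr : 0 < r - rho by rewrite subr_gt0.
exists (b + `|c| / (r - rho)) => t i j; elim: t i j => [|t IHt] i j.
  rewrite expr0 mulr1 expr0 mulr1; apply: le_trans (hb i j) _.
  by rewrite lerDl divr_ge0// ltW.
have -> : N * M ^+ t.+1 = N * (M - z%:M) * M ^+ t + z *: (N * M ^+ t).
  rewrite mulrBr mulrBl exprS mulrA -[N * z%:M]/(N *m z%:M) mul_mx_scalar.
  by rewrite -scalerAl subrK.
rewrite [X in normc X]mxE [X in normc (_ + X)]mxE.
apply: le_trans (le_normcD _ _) _.
rewrite ComplexField.Normc.normcM.
apply: le_trans (_ : `|c| * r ^+ t + rho * ((b + `|c| / (r - rho)) * r ^+ t) <= _).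
  apply: lerD.
    apply: le_trans (hc t i j) _; rewrite ler_wpM2r ?ler_norm//.
    by rewrite exprn_ge0// (le_trans rho0 (ltW rhor)).
  by rewrite ler_pM ?normc_ge0// hs// inE eqxx.
rewrite exprS mulrCA !mulrA -mulrDl ler_wpM2r//.
  by rewrite exprn_ge0// (le_trans rho0 (ltW rhor)).
have -> : r = rho + (r - rho) by rewrite addrC subrK.
rewrite [X in _ / X](_ : _ = r - rho); last by rewrite addrAC subrr add0r.
rewrite [(b + _ / _) * (_ + _)]mulrDr addrC mulrC lerD2l.
by rewrite mulrDl mulfVK ?gt_eqF// lerDr mulr_ge0// (ltW rr).
Qed.

Lemma spectral_radius_ub n (A : 'M[F]_n) l :
  eigenvalue (map_mx (real_complex F) A) l -> normc l <= spectral_radius A.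
Proof.
move=> el; apply: ub_le_sup; last by exists l.
have [s ps] := closed_field_poly_normal (char_poly (map_mx (real_complex F) A)).
exists (\sum_(z <- s) normc z) => _ [z /= ez <-].
have : z \in s.
  move: ez; rewrite eigenvalue_root_char ps.
  by rewrite (monicP (char_poly_monic _)) scale1r root_prod_XsubC.
move=> zs; rewrite (big_rem z)//= lerDl.
by apply: sumr_ge0 => y _; exact: normc_ge0.
Qed.

(** By the Cayley-Hamilton theorem the characteristic polynomial is an
    annihilating product of linear factors, as in [annihilator_decay]. *)
Lemma stable_decay n (A : 'M[F]_n) : spectral_radius A < 1 ->
  exists2 cr : F * F, 0 <= cr.2 < 1 &
    forall t i j, `|(A ^+ t) i j| <= cr.1 * cr.2 ^+ t.
Proof.
case: n A => [|n] A A1; first by exists (0, 0) => /= [|t []//]; rewrite lexx ltr01.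
set M := map_mx (real_complex F) A.
have [s ps] := closed_field_poly_normal (char_poly M).
rewrite (monicP (char_poly_monic _)) scale1r in ps.
have hs z : z \in s -> normc z <= spectral_radius A.
  by move=> zs; apply: spectral_radius_ub; rewrite eigenvalue_root_char ps root_prod_XsubC.
pose rho := Num.max 0 (spectral_radius A).
have rho0 : 0 <= rho by rewrite le_max lexx.
have rho1 : rho < 1 by rewrite gt_max ltr01.
pose r := (rho + 1) / 2.
have rr : rho < r by rewrite /r; lra.
have [||c hc] := @annihilator_decay n M s rho r rho0 rr _ 1.
- by move=> z /hs h; rewrite le_max h orbT.
- rewrite mul1r -(Cayley_Hamilton M) ps rmorph_prod; apply: eq_bigr => z _.
  by rewrite rmorphB /= horner_mx_X horner_mx_C.
exists (c, r) => /=; first by apply/andP; split; rewrite /r; lra.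
move=> t i j; have := hc t i j; rewrite mul1r.
have -> : M ^+ t = map_mx (real_complex F) (A ^+ t) by rewrite rmorphXn.
by rewrite mxE normc_real.
Qed.

(** Real and imaginary parts of a right eigenvector.  [eigenvalue] speaks of
    left eigenvectors, so the characteristic matrix has to be transposed. *)
Lemma eigenvector_parts n (A : 'M[F]_n) l :
  eigenvalue (map_mx (real_complex F) A) l ->
  exists u v : 'cV[F]_n, [/\ (u != 0) || (v != 0),
    A *m u = complex.Re l *: u - complex.Im l *: v &
    A *m v = complex.Im l *: u + complex.Re l *: v].
Proof.
move=> /eigenvalueP el.
have : \det (l%:M - map_mx (real_complex F) A)^T == 0.
  rewrite det_tr; apply/det0P; case: el => v Av v0; exists v => //.
  by rewrite mulmxBr Av mul_mx_scalar subrr.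
move=> /det0P[w w0 /eqP]; rewrite linearB /= mulmxBr subr_eq0 => /eqP ew.
have e i : \sum_j real_complex F (A i j) * w 0 j = l * w 0 i.
  have := congr1 (fun X : 'rV__ => X 0 i) ew.
  rewrite tr_scalar_mx mul_mx_scalar !mxE => ->.
  by apply: eq_bigr => j _; rewrite !mxE mulrC.
have ReD (I : Type) (r : seq I) (f : I -> F[i]) :
    complex.Re (\sum_(k <- r) f k) = \sum_(k <- r) complex.Re (f k).
  by apply: (big_morph (@complex.Re F)) => // -[a b] [c d].
have ImD (I : Type) (r : seq I) (f : I -> F[i]) :
    complex.Im (\sum_(k <- r) f k) = \sum_(k <- r) complex.Im (f k).
  by apply: (big_morph (@complex.Im F)) => // -[a b] [c d].
exists (\col_i complex.Re (w 0 i)), (\col_i complex.Im (w 0 i)); split.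
- apply: contraR w0; rewrite negb_or !negbK => /andP[/eqP u0 /eqP v0].
  apply/eqP/rowP => i; rewrite mxE; apply/eqP; rewrite eq_complex /=.
  have := congr1 (fun X : 'cV__ => X i 0) u0.
  have := congr1 (fun X : 'cV__ => X i 0) v0.
  by rewrite !mxE => -> ->; rewrite eqxx.
- apply/colP => i; have := congr1 (@complex.Re F) (e i); rewrite !mxE ReD.
  have -> : complex.Re (l * w 0 i) =
      complex.Re l * complex.Re (w 0 i) - complex.Im l * complex.Im (w 0 i).
    by case: l {ew e el} => a b; case: (w 0 i).
  move=> <-; apply: eq_bigr => j _; rewrite mxE.
  by case: (w 0 j) => a b /=; rewrite mul0r subr0.
- apply/colP => i; have := congr1 (@complex.Im F) (e i); rewrite !mxE ImD.
  have -> : complex.Im (l * w 0 i) =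
      complex.Im l * complex.Re (w 0 i) + complex.Re l * complex.Im (w 0 i).
    by case: l {ew e el} => a b; case: (w 0 i) => c d /=; rewrite addrC [b * c]mulrC [c * b]mulrC.
  move=> <-; apply: eq_bigr => j _; rewrite mxE.
  by case: (w 0 j) => a b /=; rewrite mul0r addr0.
Qed.

(** Lyapunov's criterion.  On an eigenvector the form [V] is multiplied by the
    squared modulus of the eigenvalue, and it has to decrease by a fixed
    proportion. *)
Lemma lyapunov_stable n (A V : 'M[F]_n) eps : 0 < eps -> psd V ->
  (forall x, eps * sqnorm x <= qform V x - qform V (A *m x)) ->
  spectral_radius A < 1.
Proof.
move=> e0 [Vs V0] h.
have [k k0 hk'] := qform_bounded V.
have hk x : qform V x <= k * sqnorm x by apply: le_trans (ler_norm _) (hk' x).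
(* As [V] is at most [k], it decreases at least by the factor [1 - eps / k]. *)
pose r := Num.sqrt (1 - eps / k).
have r1 : r < 1.
  rewrite /r -[ltRHS]sqrtr1 ltr_sqrt// ltrBlDr ltrDl divr_gt0//.
apply: le_lt_trans (_ : r < 1) => //.
rewrite /spectral_radius; set S := image _ _.
have hS : ubound S r.
  move=> _ [l /eigenvector_parts [u [v [uv eu ev]]] <-].
  have q0 x : eps * sqnorm x <= qform V x by apply: le_trans (h x) _; rewrite gerBl.
  have e : qform V (A *m u) + qform V (A *m v) =
      (complex.Re l ^+ 2 + complex.Im l ^+ 2) * (qform V u + qform V v).
    rewrite eu ev -scaleNr /qform !bformDl !bformDr !bformZl !bformZr.
    have -> : bform V v u = bform V u v by rewrite -bformT Vs.
    ring.
  have hu := h u; have hv := h v.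
  have s0 : 0 < sqnorm u + sqnorm v.
    by case/orP: uv => ?; [rewrite ltr_pwDl|rewrite ltr_wpDl]; rewrite ?sqnorm_gt0 ?sqnorm_ge0.
  set q := qform V u + qform V v in e.
  have qp : 0 < q.
    by rewrite /q; have := q0 u; have := q0 v; have := mulr_gt0 e0 s0; lra.
  have h1 : eps * (sqnorm u + sqnorm v) <= (1 - (complex.Re l ^+ 2 + complex.Im l ^+ 2)) * q.
    by rewrite mulrBl mul1r -e /q; lra.
  have h2 : q <= k * (sqnorm u + sqnorm v) by rewrite /q; have := hk u; have := hk v; lra.
  have h3 : eps / k * q <= (1 - (complex.Re l ^+ 2 + complex.Im l ^+ 2)) * q.
    apply: le_trans h1; rewrite -mulrA ler_pM2l// mulrC ler_pdivrMr//.
    by rewrite mulrC.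
  rewrite ler_pM2r// in h3.
  have -> : normc l = Num.sqrt (complex.Re l ^+ 2 + complex.Im l ^+ 2) by case: l {eu ev e h1 h3}.
  by apply: ler_wsqrtr; lra.
have [S0|/set0P S0] := eqVneq S set0; first by rewrite S0 sup0 sqrtr_ge0.
exact: ge_sup.
Qed.

End Stability.

(** * The Stein equation *)

Section Lyapunov.
Variable F : realType.

Definition stable n (A : 'M[F]_n) : Prop := spectral_radius A < 1.

(** The solution [X] of the Stein equation [X = S + A^T *m X *m A], obtained by
    inverting a matrix of the operator [X |-> X - A^T *m X *m A]: this makes
    linearity in [S] immediate, without a series. *)
Definition lyap n (A S : 'M[F]_n) : 'M[F]_n :=
  vec_mx (mxvec S *m invmx (1%:M - lin_mx (mulmxr A \o mulmx A^T))).

Lemma pow_cvg n (A : 'M[F]_n) i j : stable A -> (A ^+ t) i j @[t --> \oo] --> (0 : F).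
Proof.
move=> /stable_decay[[c r] /= /andP[r0 r1] h].
apply: norm_cvg0; apply: (@squeeze_cvgr _ _ _ _ (fun=> 0) (geometric c r)).
- by near=> t; rewrite normr_ge0 /=; exact: h.
- exact: cvg_cst.
- by apply: cvg_geometric; rewrite ger0_norm.
Unshelve. all: by end_near. Qed.

Lemma bform_pow_cvg n (A X : 'M[F]_n) x y : stable A ->
  bform X (A ^+ t *m x) (A ^+ t *m y) @[t --> \oo] --> (0 : F).
Proof.
move=> sA.
have vc z i : (A ^+ t *m (z : 'cV[F]_n)) i 0 @[t --> \oo] --> (0 : F).
  have -> : (fun t => (A ^+ t *m z) i 0) = (fun t => \sum_j (A ^+ t) i j * z j 0).
    by apply/funext => t; rewrite mxE.
  apply: cvg_sum0 => j.
  have -> : (0 : F) = 0 * z j 0 by rewrite mul0r.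
  apply: cvgM; first exact: pow_cvg.
  exact: cvg_cst.
under eq_fun do rewrite bformE.
apply: cvg_sum0 => i; apply: cvg_sum0 => j.
have -> : (0 : F) = 0 * X i j * 0 by rewrite mulr0.
apply: cvgM; last exact: vc.
by apply: cvgM; [exact: vc|exact: cvg_cst].
Qed.

Lemma lyap_unfold n (A S X : 'M[F]_n) x t : X = S + A^T *m X *m A ->
  qform X x = \sum_(k < t) qform S (A ^+ k *m x) + qform X (A ^+ t *m x).
Proof.
move=> eX; elim: t => [|t IH]; first by rewrite big_ord0 add0r expr0 mul1mx.
rewrite big_ord_recr /= IH -addrA; congr (_ + _).
by rewrite {1}eX qformDm qform_mul exprS mulmxA.
Qed.

Lemma lyap_unfold_cvg n (A S X : 'M[F]_n) x : stable A -> X = S + A^T *m X *m A ->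
  \sum_(k < t) qform S (A ^+ k *m x) @[t --> \oo] --> qform X x.
Proof.
move=> sA eX.
have -> : (fun t => \sum_(k < t) qform S (A ^+ k *m x)) =
    (fun t => qform X x - qform X (A ^+ t *m x)).
  by apply/funext => t; rewrite (lyap_unfold x t eX) addrK.
have h : qform X (A ^+ t *m x) @[t --> \oo] --> (0 : F) by exact: bform_pow_cvg.
by have := cvgB (cvg_cst (qform X x) (F := \oo)) h; rewrite subr0; exact.
Qed.

(** A solution of the homogeneous equation is unchanged when its two arguments
    are multiplied by powers of [A], which tend to [0]. *)
Lemma stein_inj n (A X : 'M[F]_n) : stable A -> X = A^T *m X *m A -> X = 0.
Proof.
move=> sA eX; apply/matrixP => i j; rewrite mxE.
have <- : bform X (delta_mx i 0) (delta_mx j 0) = X i j.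
  by rewrite /bform trmx_delta -rowE -colE !mxE.
set x := delta_mx i 0; set y := delta_mx j 0.
have e t : bform X (A ^+ t *m x) (A ^+ t *m y) = bform X x y.
  elim: t => [|t IH]; first by rewrite expr0 !mul1mx.
  by rewrite -IH {2}eX bform_congr exprS !mulmxA.
have := @bform_pow_cvg n A X x y sA.
under eq_fun do rewrite e.
by move=> /(cvg_lim (@norm_hausdorff _ _)) <-; rewrite lim_cst//; exact: norm_hausdorff.
Qed.

Lemma stein_unit n (A : 'M[F]_n) : stable A ->
  1%:M - lin_mx (mulmxr A \o mulmx A^T) \in unitmx.
Proof.
move=> sA; rewrite -row_free_unit; apply: inj_row_free => v.
rewrite mulmxBr mulmx1 mul_rV_lin => /eqP; rewrite subr_eq0 => /eqP e.
rewrite -[v]vec_mxK (_ : vec_mx v = 0) ?linear0//.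
by apply: (stein_inj sA); rewrite {1}e mxvecK.
Qed.

Lemma lyapE n (A S : 'M[F]_n) : stable A -> lyap A S = S + A^T *m lyap A S *m A.
Proof.
move=> sA; set X := lyap A S.
have : mxvec X *m (1%:M - lin_mx (mulmxr A \o mulmx A^T)) = mxvec S.
  by rewrite /X /lyap vec_mxK mulmxKV// stein_unit.
rewrite mulmxBr mulmx1 mul_vec_lin /= -linearB /= => /(can_inj mxvecK) <-.
by rewrite subrK.
Qed.

Lemma lyap_uniq n (A S X : 'M[F]_n) : stable A -> X = S + A^T *m X *m A -> X = lyap A S.
Proof.
move=> sA eX; apply/eqP; rewrite -subr_eq0; apply/eqP/(stein_inj sA).
rewrite {1}eX {1}lyapE// mulmxBr mulmxBl opprD addrACA subrr add0r//.
Qed.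

Lemma lyapD n (A S S' : 'M[F]_n) : lyap A (S + S') = lyap A S + lyap A S'.
Proof. by rewrite /lyap linearD mulmxDl linearD. Qed.

Lemma lyapZ n a (A S : 'M[F]_n) : lyap A (a *: S) = a *: lyap A S.
Proof. by rewrite /lyap linearZ /= -scalemxAl linearZ. Qed.

Lemma lyapB n (A S S' : 'M[F]_n) : lyap A (S - S') = lyap A S - lyap A S'.
Proof. by rewrite -scaleN1r lyapD lyapZ scaleN1r. Qed.

Lemma lyap_sym n (A S : 'M[F]_n) : stable A -> S^T = S -> (lyap A S)^T = lyap A S.
Proof.
move=> sA Ss; apply: lyap_uniq => //.
by rewrite {1}lyapE// linearD /= Ss !trmx_mul trmxK mulmxA.
Qed.

(** [qform (lyap A S) x] is the sum of the [qform S (A ^+ k *m x)]; only the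
    term [k = 0] is kept. *)
Lemma lyap_ge0 n (A S : 'M[F]_n) : stable A -> (forall x, 0 <= qform S x) ->
  forall x, qform S x <= qform (lyap A S) x.
Proof.
move=> sA S0 x; have := @lyap_unfold_cvg n A S _ x sA (lyapE S sA).
move=> /(cvg_lim (@norm_hausdorff _ _)) <-.
apply: limr_ge.
  by apply/cvg_ex; eexists; exact: lyap_unfold_cvg sA (lyapE S sA).
exists 1%N => //= -[//|t] _; rewrite big_ord_recl expr0 mul1mx lerDl.
by apply: sumr_ge0 => k _; exact: S0.
Qed.

(** Monotonicity of the solution operator: all bounds on derivatives of the cost
    are obtained by bounding right-hand sides and applying it. *)
Lemma lyap_le n (A S S' : 'M[F]_n) : stable A ->
  (forall x, qform S x <= qform S' x) ->
  forall x, qform (lyap A S) x <= qform (lyap A S') x.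
Proof.
move=> sA h x; rewrite -subr_ge0 -qformBm -lyapB.
have h' y : 0 <= qform (S' - S) y by rewrite qformBm subr_ge0.
by apply: le_trans (lyap_ge0 sA h' x).
Qed.

Lemma lyap_norm_le n (A S V : 'M[F]_n) : stable A ->
  (forall x, `|qform S x| <= qform V x) ->
  forall x, `|qform (lyap A S) x| <= qform (lyap A V) x.
Proof.
move=> sA h x; rewrite ler_norml; apply/andP; split.
  rewrite -mulN1r -qformZm -lyapZ; apply: lyap_le => // y.
  by rewrite qformZm mulN1r; have := h y; rewrite ler_norml => /andP[].
by apply: lyap_le => // y; apply: le_trans (h y); exact: ler_norm.
Qed.

End Lyapunov.

(** * Perturbation of the Stein equation *)

Section MatrixLimits.
Variable F : realType.

Definition mcvg (T : Type) (G : set_system T) p q (X : T -> 'M[F]_(p, q))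
    (L : 'M[F]_(p, q)) : Prop :=
  forall i j, X t i j @[t --> G] --> L i j.

Section limits.
Context (T : Type) (G : set_system T) {FG : Filter G}.

Lemma mcvg_cst p q (L : 'M[F]_(p, q)) : mcvg G (fun=> L) L.
Proof. by move=> i j; exact: cvg_cst. Qed.

Lemma mcvgD p q (X Y : T -> 'M[F]_(p, q)) L M :
  mcvg G X L -> mcvg G Y M -> mcvg G (fun t => X t + Y t) (L + M).
Proof.
move=> hX hY i j; rewrite mxE; under eq_fun do rewrite mxE.
by apply: cvgD; [exact: hX|exact: hY].
Qed.

Lemma mcvgB p q (X Y : T -> 'M[F]_(p, q)) L M :
  mcvg G X L -> mcvg G Y M -> mcvg G (fun t => X t - Y t) (L - M).
Proof.
move=> hX hY i j; rewrite !mxE; under eq_fun do rewrite !mxE.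
by apply: cvgB; [exact: hX|exact: hY].
Qed.

Lemma mcvgM p q r (X : T -> 'M[F]_(p, q)) (Y : T -> 'M[F]_(q, r)) L M :
  mcvg G X L -> mcvg G Y M -> mcvg G (fun t => X t *m Y t) (L *m M).
Proof.
move=> hX hY i j; rewrite mxE; under eq_fun do rewrite mxE.
by apply: cvg_sum => k; apply: cvgM; [exact: hX|exact: hY].
Qed.

Lemma mcvg_tr p q (X : T -> 'M[F]_(p, q)) L :
  mcvg G X L -> mcvg G (fun t => (X t)^T) L^T.
Proof. by move=> h i j; rewrite mxE; under eq_fun do rewrite mxE; exact: h. Qed.

Lemma mcvg_near p q (X : T -> 'M[F]_(p, q)) L e : 0 < e -> mcvg G X L ->
  \forall t \near G, forall i j, `|(X t - L) i j| <= e.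
Proof.
move=> e0 h; apply: filter_forall => i; apply: filter_forall => j.
have /cvgrPdist_le/(_ e e0) := h i j.
by apply: filterS => t; rewrite !mxE distrC.
Qed.

Lemma mcvg_qform n (X : T -> 'M[F]_n) L e : 0 < e -> mcvg G X L ->
  \forall t \near G, forall x, `|qform (X t - L) x| <= e * sqnorm x.
Proof.
move=> e0 h; have e1 : 0 < e / n.+1%:R by rewrite divr_gt0.
apply: filterS (mcvg_near e1 h) => t ht x.
apply: le_trans (qform_entry x ht) _; rewrite ler_wpM2r ?sqnorm_ge0//.
rewrite -mulrA ler_piMr// ?(ltW e0)// mulrC ler_pdivrMr// mul1r ler_nat.
exact: leqnSn.
Qed.

(** One Lyapunov form [V] certifies the stability of every matrix close to
    [A0], with a uniform rate of decrease. *)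
Lemma lyapunov_near n (A : T -> 'M[F]_n) A0 : stable A0 -> mcvg G A A0 ->
  \forall t \near G, forall x,
    sqnorm x <= 2 * qform (lyap A0 1%:M - (A t)^T *m lyap A0 1%:M *m A t) x.
Proof.
move=> sA hA; set V := lyap A0 1%:M.
have hM : mcvg G (fun t => V - (A t)^T *m V *m A t) 1%:M.
  have <- : V - A0^T *m V *m A0 = 1%:M by rewrite {1}/V lyapE// addrK.
  apply: mcvgB; first exact: mcvg_cst.
  by apply: mcvgM => //; apply: mcvgM; [exact: mcvg_tr|exact: mcvg_cst].
have h2 : 0 < 2^-1 :> F by rewrite invr_gt0.
apply: filterS (mcvg_qform h2 hM) => t ht x.
have := ht x; rewrite qformBm qform1 ler_norml => /andP[h _].
by move: h; set a := qform _ _; set b := sqnorm _; lra.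
Qed.

Lemma lyap1_psd n (A : 'M[F]_n) : stable A -> psd (lyap A 1%:M).
Proof.
move=> sA; split; first by apply: lyap_sym => //; exact: trmx1.
move=> x; apply: le_trans (lyap_ge0 sA _ x); rewrite ?qform1 ?sqnorm_ge0//.
by move=> y; rewrite qform1 sqnorm_ge0.
Qed.

Lemma stable_near n (A : T -> 'M[F]_n) A0 : stable A0 -> mcvg G A A0 ->
  \forall t \near G, stable (A t).
Proof.
move=> sA hA; apply: filterS (lyapunov_near sA hA) => t ht.
apply: (@lyapunov_stable _ _ _ (lyap A0 1%:M) 2^-1); first by rewrite invr_gt0.
  exact: lyap1_psd.
move=> x; have := ht x; rewrite qformBm qform_mul.
rewrite -/(qform _ (A t *m x)); set a := qform _ _; set b := qform _ _.
set c := sqnorm _; lra.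
Qed.

(** A small [S t] is dominated by a small multiple of
    [V - (A t)^T *m V *m A t], whose solution is that multiple of [V]. *)
Lemma lyap_mcvg0 n (A S : T -> 'M[F]_n) A0 : stable A0 -> mcvg G A A0 ->
  (forall t, (S t)^T = S t) -> mcvg G S 0 ->
  mcvg G (fun t => lyap (A t) (S t)) 0.
Proof.
move=> sA hA Ss hS i j; rewrite mxE; apply/cvgr0Pnorm_le => e e0.
set V := lyap A0 1%:M; have [k k0 hk] := qform_bounded V.
have d0 : 0 < e / (2 * k) by rewrite divr_gt0// mulr_gt0.
move: (stable_near sA hA) (lyapunov_near sA hA) (mcvg_qform d0 hS).
apply: filterS3 => t st hV hSt'.
have hSt x : `|qform (S t) x| <= e / (2 * k) * sqnorm x.
  by have := hSt' x; rewrite subr0.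
apply: norm_entry => [|x]; first exact: lyap_sym.
pose c := e / k.
have /(lyap_norm_le st)/(_ x) : forall y,
    `|qform (S t) y| <= qform (c *: (V - (A t)^T *m V *m A t)) y.
  move=> y; apply: le_trans (hSt y) _; rewrite qformZm.
  apply: le_trans (ler_wpM2l (ltW d0) (hV y)) _.
  rewrite le_eqVlt; apply/orP; left; apply/eqP; rewrite /c.
  by field; rewrite gt_eqF.
move=> /le_trans; apply.
have <- : c *: V = lyap (A t) (c *: (V - (A t)^T *m V *m A t)).
  by apply: lyap_uniq => //; rewrite -scalemxAr -scalemxAl -scalerDr subrK.
rewrite qformZm; apply: le_trans (_ : c * (k * sqnorm x) <= _).
  by rewrite ler_pM2l ?divr_gt0//; apply: le_trans (ler_norm _) (hk x).
by rewrite mulrA /c mulfVK// gt_eqF.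
Qed.

End limits.

End MatrixLimits.

Section MatrixPaths.
Variable F : realType.

Lemma is_derive0P (f : F -> F) df :
  is_derive (0 : F) (1 : F) f df <->
  h^-1 * (f h - f 0) @[h --> (0 : F)^'] --> df.
Proof.
have e : (fun h : F => h^-1 *: ((f \o shift 0) (h *: (1 : F)) - f 0)) =
    (fun h => h^-1 * (f h - f 0)).
  by apply/funext => h /=; rewrite addr0 [h *: 1]mulr1.
split=> [[]|h]; first by rewrite /derivable /derive e => /cvgP ? <-.
split; first by rewrite /derivable e; apply/cvg_ex; exists df.
by rewrite /derive e; exact: cvg_lim.
Qed.

(** The derivative at [0] as a limit of difference quotients of matrices, so that
    the rules for [mcvg] give those for products and traces. *)
Definition mderiv p q (X : F -> 'M[F]_(p, q)) (X1 : 'M[F]_(p, q)) : Prop :=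
  mcvg (0 : F)^' (fun h => h^-1 *: (X h - X 0)) X1.

Lemma mcvg_ext (T : Type) (G : set_system T) {FG : Filter G} p q
    (X Y : T -> 'M[F]_(p, q)) L :
  (\forall t \near G, X t = Y t) -> mcvg G X L -> mcvg G Y L.
Proof.
move=> XY h i j; apply: cvg_trans (h i j); apply: near_eq_cvg.
by apply: filterS XY => t ->.
Qed.

Lemma mcvg_trace (T : Type) (G : set_system T) {FG : Filter G} n
    (X : T -> 'M[F]_n) L : mcvg G X L -> \tr (X t) @[t --> G] --> \tr L.
Proof. by move=> h; apply: cvg_sum => i; exact: h. Qed.

Lemma mderiv_cvg p q (X : F -> 'M[F]_(p, q)) X1 :
  mderiv X X1 -> mcvg (0 : F)^' X (X 0).
Proof.
move=> h.
have h1 : mcvg (0 : F)^' (fun t => X 0 + t *: (t^-1 *: (X t - X 0))) (X 0 + 0 *: X1).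
  apply: mcvgD; first exact: mcvg_cst.
  move=> i j; rewrite mxE; under eq_fun do rewrite mxE.
  by apply: cvgM; [exact: nbhs_dnbhs|exact: h].
rewrite scale0r addr0 in h1; apply: (mcvg_ext _ h1).
near=> t; rewrite scalerA mulfV ?scale1r 1?addrC ?subrK//.
by near: t; exact: nbhs_dnbhs_neq.
Unshelve. all: by end_near. Qed.

Lemma mderiv_ext p q (X Y : F -> 'M[F]_(p, q)) X1 :
  (forall h, X h = Y h) -> mderiv X X1 -> mderiv Y X1.
Proof. by move=> /funext ->. Qed.

Lemma mderiv_cst p q (M : 'M[F]_(p, q)) : mderiv (fun=> M) 0.
Proof.
rewrite /mderiv; under eq_fun do rewrite subrr scaler0.
exact: mcvg_cst.
Qed.

Lemma mderiv_affine p q (M N : 'M[F]_(p, q)) : mderiv (fun h => M + h *: N) N.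
Proof.
have hN : mcvg (0 : F)^' (fun=> N) N by exact: mcvg_cst.
rewrite /mderiv; apply: (mcvg_ext _ hN); near=> h.
rewrite scale0r addr0 addrC addKr scalerA mulVf ?scale1r//.
by near: h; exact: nbhs_dnbhs_neq.
Unshelve. all: by end_near. Qed.

Lemma mderivD p q (X Y : F -> 'M[F]_(p, q)) X1 Y1 :
  mderiv X X1 -> mderiv Y Y1 -> mderiv (fun h => X h + Y h) (X1 + Y1).
Proof.
move=> hX hY; rewrite /mderiv; under eq_fun do rewrite opprD addrACA scalerDr.
exact: mcvgD.
Qed.

Lemma mderivN p q (X : F -> 'M[F]_(p, q)) X1 :
  mderiv X X1 -> mderiv (fun h => - X h) (- X1).
Proof.
move=> hX.
have h0 : mcvg (0 : F)^' (fun=> 0 : 'M[F]_(p, q)) 0 by exact: mcvg_cst.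
have := mcvgB h0 hX; rewrite sub0r => h; rewrite /mderiv; apply: (mcvg_ext _ (h _)).
by apply: nearW => t; rewrite sub0r -scalerN opprB opprK addrC.
Qed.

Lemma mderivB p q (X Y : F -> 'M[F]_(p, q)) X1 Y1 :
  mderiv X X1 -> mderiv Y Y1 -> mderiv (fun h => X h - Y h) (X1 - Y1).
Proof. by move=> hX hY; apply: mderivD => //; exact: mderivN. Qed.

Lemma mderiv_tr p q (X : F -> 'M[F]_(p, q)) X1 :
  mderiv X X1 -> mderiv (fun h => (X h)^T) X1^T.
Proof.
move=> hX; rewrite /mderiv; under eq_fun do rewrite -linearB -linearZ.
exact: mcvg_tr.
Qed.

Lemma mderivM p q r (X : F -> 'M[F]_(p, q)) (Y : F -> 'M[F]_(q, r)) X1 Y1 :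
  mderiv X X1 -> mderiv Y Y1 ->
  mderiv (fun h => X h *m Y h) (X1 *m Y 0 + X 0 *m Y1).
Proof.
move=> hX hY; rewrite /mderiv.
have -> : (fun h => h^-1 *: (X h *m Y h - X 0 *m Y 0)) =
    (fun h => (h^-1 *: (X h - X 0)) *m Y h + X 0 *m (h^-1 *: (Y h - Y 0))).
  apply/funext => h; rewrite -scalemxAl -scalemxAr -scalerDr mulmxBl mulmxBr.
  by rewrite addrA subrK.
apply: mcvgD; first by apply: mcvgM => //; exact: mderiv_cvg hY.
by apply: mcvgM => //; exact: mcvg_cst.
Qed.

Lemma mderiv_symmx n (X : F -> 'M[F]_n) X1 :
  mderiv X X1 -> mderiv (fun h => symmx (X h)) (symmx X1).
Proof. by move=> h; apply: mderivD => //; exact: mderiv_tr. Qed.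

Lemma mderiv_trace n (X : F -> 'M[F]_n) X1 (M : 'M[F]_n) :
  mderiv X X1 -> is_derive (0 : F) (1 : F) (fun h => \tr (X h *m M)) (\tr (X1 *m M)).
Proof.
move=> h; apply/is_derive0P.
under eq_fun do rewrite -linearB -linearZ /= -mulmxBl scalemxAl.
by apply: mcvg_trace; apply: mcvgM => //; exact: mcvg_cst.
Qed.

(** Implicit differentiation of [X = S + A^T *m X *m A].  The error of the
    difference quotient solves an equation of the same type, with a right-hand
    side that tends to [0]. *)
Lemma mderiv_lyap n (A S : F -> 'M[F]_n) A1 S1 : stable (A 0) ->
  (forall h, (S h)^T = S h) -> S1^T = S1 -> mderiv A A1 -> mderiv S S1 ->
  mderiv (fun h => lyap (A h) (S h))
    (lyap (A 0) (S1 + symmx (A1^T *m lyap (A 0) (S 0) *m A 0))).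
Proof.
move=> sA Ss S1s hA hS; set X0 := lyap (A 0) (S 0).
have X0s : X0^T = X0 by exact: lyap_sym.
set G1 := S1 + _; set X1 := lyap (A 0) G1.
pose T h := S h + (A h)^T *m X0 *m A h.
have T0 : T 0 = X0 by rewrite /T /X0 -lyapE.
have hT : mderiv T G1.
  apply: mderivD => //.
  have := mderivM (mderivM (mderiv_tr hA) (mderiv_cst X0)) hA.
  by rewrite mulmx0 addr0 /symmx !trmx_mul trmxK X0s mulmxA.
pose G h := h^-1 *: (T h - T 0) - (X1 - (A h)^T *m X1 *m A h).
have hG : mcvg (0 : F)^' G 0.
  have -> : 0 = G1 - (X1 - (A 0)^T *m X1 *m A 0).
    by rewrite {1}/X1 (lyapE _ sA) -/X1 addrK subrr.
  apply: mcvgB => //; apply: mcvgB; first exact: mcvg_cst.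
  have cA := mderiv_cvg hA.
  by apply: mcvgM => //; apply: mcvgM; [exact: mcvg_tr|exact: mcvg_cst].
have Gs h : (G h)^T = G h.
  have G1s : G1^T = G1 by rewrite /G1 linearD /= S1s symmx_sym.
  have X1s : X1^T = X1 by exact: lyap_sym.
  rewrite /G /T !(linearB, linearD, linearZ) /= !trmx_mul !trmxK X0s X1s !Ss.
  by rewrite !mulmxA -!scalerDr.
have hX : mcvg (0 : F)^' (fun h => lyap (A h) (G h)) 0.
  exact: (lyap_mcvg0 sA (mderiv_cvg hA) Gs hG).
have hX1 : mcvg (0 : F)^' (fun h => lyap (A h) (G h) + X1) (0 + X1).
  by apply: mcvgD => //; exact: mcvg_cst.
rewrite add0r in hX1; rewrite /mderiv; apply: (mcvg_ext _ hX1); near=> h.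
have sh : stable (A h) by near: h; exact: (stable_near sA (mderiv_cvg hA)).
set X := lyap (A h) (S h).
have eX : X - X0 = T h - T 0 + (A h)^T *m (X - X0) *m A h.
  rewrite T0 {1}/X (lyapE (S h) sh) -/X /T mulmxBr mulmxBl.
  set a := S h; set b := _ *m X *m _; set c := _ *m X0 *m _.
  by rewrite [a + c - X0]addrAC -[RHS]addrA [c + _]addrC subrK addrAC.
apply/eqP; rewrite eq_sym -subr_eq; apply/eqP; apply: lyap_uniq => //.
move: (X - X0) eX => D eX.
rewrite {1}eX mulmxBr mulmxBl. rewrite -scalemxAr -scalemxAl scalerDr /G.
rewrite -/(T h).
set a := _ *: (T h - T 0); set b := _ *: (_ *m D *m _); set c := _ *m X1 *m _.
by apply/matrixP => i j; rewrite !mxE; ring.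
Unshelve. all: by end_near. Qed.

End MatrixPaths.

(** * Derivatives of the cost matrix *)

Section Sensitivities.
Local Opaque lyap.
Variables (F : realType) (n m d : nat).
Variables (A : 'M[F]_n) (B : 'M[F]_(n, m)) (C : 'M[F]_(d, n)).
Variables (Q : 'M[F]_n) (R : 'M[F]_m).
Hypotheses (Qs : Q^T = Q) (Rs : R^T = R).
Local Notation AK := (closed_loop A B C).

Definition cost_weight (K : 'M[F]_(m, d)) : 'M[F]_n :=
  Q + (K *m C)^T *m R *m (K *m C).

Definition cost_matrix (K : 'M[F]_(m, d)) : 'M[F]_n := lyap (AK K) (cost_weight K).

(** The derivative of [cost_matrix] at [K] in the direction [Z] solves the Stein
    equation of the same closed loop with right-hand side [rhs1 K Z].  [rhs2]
    and [rhs3] play this role for the iterated derivatives in the directions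
    [Z], [E] and [Z], [E], [D]; the negative terms come from the product rule
    for [AK^T *m _ *m AK], as the closed loop has derivative [- B *m Z *m C]. *)
Definition rhs1 (K Z : 'M[F]_(m, d)) : 'M[F]_n :=
  symmx ((Z *m C)^T *m R *m (K *m C))
  - symmx ((B *m Z *m C)^T *m cost_matrix K *m AK K).

Definition dcost1 (K Z : 'M[F]_(m, d)) : 'M[F]_n := lyap (AK K) (rhs1 K Z).

Definition rhs2 (K Z E : 'M[F]_(m, d)) : 'M[F]_n :=
  symmx ((Z *m C)^T *m R *m (E *m C))
  + symmx ((B *m Z *m C)^T *m cost_matrix K *m (B *m E *m C))
  - symmx ((B *m Z *m C)^T *m dcost1 K E *m AK K)
  - symmx ((B *m E *m C)^T *m dcost1 K Z *m AK K).

Definition dcost2 (K Z E : 'M[F]_(m, d)) : 'M[F]_n := lyap (AK K) (rhs2 K Z E).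

Definition rhs3 (K Z E D : 'M[F]_(m, d)) : 'M[F]_n :=
  symmx ((B *m Z *m C)^T *m dcost1 K D *m (B *m E *m C))
  + symmx ((B *m Z *m C)^T *m dcost1 K E *m (B *m D *m C))
  + symmx ((B *m E *m C)^T *m dcost1 K Z *m (B *m D *m C))
  - symmx ((B *m Z *m C)^T *m dcost2 K E D *m AK K)
  - symmx ((B *m E *m C)^T *m dcost2 K Z D *m AK K)
  - symmx ((B *m D *m C)^T *m dcost2 K Z E *m AK K).

Definition dcost3 (K Z E D : 'M[F]_(m, d)) : 'M[F]_n := lyap (AK K) (rhs3 K Z E D).

Lemma symmxD (M N : 'M[F]_n) : symmx (M + N) = symmx M + symmx N.
Proof. by rewrite /symmx linearD addrACA. Qed.

Lemma symmxN (M : 'M[F]_n) : symmx (- M) = - symmx M.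
Proof. by rewrite /symmx linearN -opprD. Qed.

Lemma symmxZ a (M : 'M[F]_n) : symmx (a *: M) = a *: symmx M.
Proof. by rewrite /symmx linearZ -scalerDr. Qed.

Lemma symmxT (M : 'M[F]_n) : symmx M^T = symmx M.
Proof. by rewrite /symmx trmxK addrC. Qed.

Lemma symmx_swap p (M : 'M[F]_p) (U V : 'M[F]_(p, n)) : M^T = M ->
  symmx (U^T *m M *m V) = symmx (V^T *m M *m U).
Proof. by move=> Ms; rewrite -symmxT !trmx_mul trmxK Ms mulmxA. Qed.

Lemma sym_add (M N : 'M[F]_n) : M^T = M -> N^T = N -> (M + N)^T = M + N.
Proof. by move=> Ms Ns; rewrite linearD /= Ms Ns. Qed.

Lemma sym_sub (M N : 'M[F]_n) : M^T = M -> N^T = N -> (M - N)^T = M - N.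
Proof. by move=> Ms Ns; rewrite linearB /= Ms Ns. Qed.

Lemma cost_weight_sym K : (cost_weight K)^T = cost_weight K.
Proof. by rewrite /cost_weight linearD /= Qs !trmx_mul Rs !trmxK !mulmxA. Qed.

Lemma rhs1_sym K Z : (rhs1 K Z)^T = rhs1 K Z.
Proof. by apply: sym_sub; exact: symmx_sym. Qed.

Lemma rhs2_sym K Z E : (rhs2 K Z E)^T = rhs2 K Z E.
Proof.
do 2!(apply: sym_sub; last exact: symmx_sym).
by apply: sym_add; exact: symmx_sym.
Qed.

Lemma cost_matrix_sym K : stable (AK K) -> (cost_matrix K)^T = cost_matrix K.
Proof. by move=> sK; apply: lyap_sym => //; exact: cost_weight_sym. Qed.

Lemma dcost1_sym K Z : stable (AK K) -> (dcost1 K Z)^T = dcost1 K Z.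
Proof. by move=> sK; apply: lyap_sym => //; exact: rhs1_sym. Qed.

Lemma dcost2_sym K Z E : stable (AK K) -> (dcost2 K Z E)^T = dcost2 K Z E.
Proof. by move=> sK; apply: lyap_sym => //; exact: rhs2_sym. Qed.

Lemma mderiv_eq p q (X : F -> 'M[F]_(p, q)) X1 Y1 :
  mderiv X X1 -> X1 = Y1 -> mderiv X Y1.
Proof. by move=> h <-. Qed.

Lemma mderiv_closed_loop (K E : 'M[F]_(m, d)) :
  mderiv (fun h => AK (K + h *: E)) (- (B *m E *m C)).
Proof.
have hA := @mderiv_affine F _ _ (AK K) (- (B *m E *m C)).
apply: (mderiv_ext _ hA) => h.
rewrite /closed_loop mulmxDr mulmxDl opprD addrA scalerN.
by rewrite -scalemxAr -scalemxAl.
Qed.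

Lemma mderiv_gain (K E : 'M[F]_(m, d)) : mderiv (fun h => (K + h *: E) *m C) (E *m C).
Proof.
have hK := @mderiv_affine F _ _ (K *m C) (E *m C).
apply: (mderiv_ext _ hK) => h.
by rewrite mulmxDl scalemxAl.
Qed.

Lemma mderivMl p q r (N : 'M[F]_(p, q)) (X : F -> 'M[F]_(q, r)) X1 :
  mderiv X X1 -> mderiv (fun h => N *m X h) (N *m X1).
Proof.
move=> h; apply: (mderiv_eq (mderivM (@mderiv_cst F _ _ N) h)).
by rewrite mul0mx add0r.
Qed.

Lemma mderivMr p q r (N : 'M[F]_(q, r)) (X : F -> 'M[F]_(p, q)) X1 :
  mderiv X X1 -> mderiv (fun h => X h *m N) (X1 *m N).
Proof.
move=> h; apply: (mderiv_eq (mderivM h (@mderiv_cst F _ _ N))).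
by rewrite mulmx0 addr0.
Qed.

(** Whatever the right-hand side [S], the variation of the closed loop adds the
    same feedback term. *)
Lemma mderiv_lyap_loop K E S S1 X : stable (AK K) ->
  (forall h, (S h)^T = S h) -> S1^T = S1 -> mderiv S S1 ->
  X = lyap (AK K) (S 0) ->
  mderiv (fun h => lyap (AK (K + h *: E)) (S h))
    (lyap (AK K) (S1 - symmx ((B *m E *m C)^T *m X *m AK K))).
Proof.
move=> sK Ss S1s hS ->.
have sK' : stable (AK (K + 0 *: E)) by rewrite scale0r addr0.
have hA : mderiv (fun h => AK (K + h *: E)) (- (B *m E *m C)).
  exact: mderiv_closed_loop.
have := @mderiv_lyap F n (fun h => AK (K + h *: E)) S _ _ sK' Ss S1s hA hS.
move=> /mderiv_eq; apply.
by rewrite scale0r addr0 linearN /= !mulNmx symmxN.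
Qed.

Lemma mderiv_cost_matrix K E : stable (AK K) ->
  mderiv (fun h => cost_matrix (K + h *: E)) (dcost1 K E).
Proof.
move=> sK; apply: mderiv_lyap_loop => //.
- by move=> h; exact: cost_weight_sym.
- exact: symmx_sym.
- have hU : mderiv (fun h => (K + h *: E) *m C) (E *m C) by exact: mderiv_gain.
  have := mderivD (@mderiv_cst F _ _ Q) (mderivM (mderivM (mderiv_tr hU) (@mderiv_cst F _ _ R)) hU).
  move=> /mderiv_eq; apply.
  by rewrite mulmx0 addr0 scale0r addr0 add0r /symmx !trmx_mul !trmxK Rs !mulmxA.
- by rewrite scale0r addr0.
Qed.

Lemma mderiv_feedback K Z E (X : F -> 'M[F]_n) X1 : mderiv X X1 ->
  mderiv (fun h => symmx ((B *m Z *m C)^T *m X h *m AK (K + h *: E)))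
    (symmx ((B *m Z *m C)^T *m X1 *m AK K)
     - symmx ((B *m Z *m C)^T *m X 0 *m (B *m E *m C))).
Proof.
move=> hX; have hA : mderiv (fun h => AK (K + h *: E)) (- (B *m E *m C)).
  exact: mderiv_closed_loop.
have hM : mderiv (fun h => (B *m Z *m C)^T *m X h) ((B *m Z *m C)^T *m X1).
  exact: mderivMl.
have := mderivM hM hA.
move=> /mderiv_symmx /mderiv_eq; apply.
by rewrite symmxD mulmxN symmxN scale0r addr0.
Qed.

Lemma mderiv_dcost1 K Z E : stable (AK K) ->
  mderiv (fun h => dcost1 (K + h *: E) Z) (dcost2 K Z E).
Proof.
move=> sK.
have hP : mderiv (fun h => cost_matrix (K + h *: E)) (dcost1 K E).
  exact: mderiv_cost_matrix.
pose S1 := symmx ((Z *m C)^T *m R *m (E *m C))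
  + symmx ((B *m Z *m C)^T *m cost_matrix K *m (B *m E *m C))
  - symmx ((B *m Z *m C)^T *m dcost1 K E *m AK K).
apply: (@mderiv_lyap_loop K E (fun h => rhs1 (K + h *: E) Z) S1 (dcost1 K Z)).
- exact: sK.
- by move=> h; exact: rhs1_sym.
- by rewrite /S1; apply: sym_sub; last exact: symmx_sym; apply: sym_add; exact: symmx_sym.
- apply: mderiv_eq.
    apply: mderivB; last exact: mderiv_feedback hP.
    by apply: mderiv_symmx; apply: mderivMl; exact: mderiv_gain.
  by rewrite opprB scale0r addr0 addrA.
- by rewrite scale0r addr0.
Qed.

Lemma mderiv_dcost2 K Z E D : stable (AK K) ->
  mderiv (fun h => dcost2 (K + h *: D) Z E) (dcost3 K Z E D).
Proof.
move=> sK.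
have hP : mderiv (fun h => cost_matrix (K + h *: D)) (dcost1 K D).
  exact: mderiv_cost_matrix.
have hZ : mderiv (fun h => dcost1 (K + h *: D) Z) (dcost2 K Z D).
  exact: mderiv_dcost1.
have hE : mderiv (fun h => dcost1 (K + h *: D) E) (dcost2 K E D).
  exact: mderiv_dcost1.
pose S1 := symmx ((B *m Z *m C)^T *m dcost1 K D *m (B *m E *m C))
  + symmx ((B *m Z *m C)^T *m dcost1 K E *m (B *m D *m C))
  + symmx ((B *m E *m C)^T *m dcost1 K Z *m (B *m D *m C))
  - symmx ((B *m Z *m C)^T *m dcost2 K E D *m AK K)
  - symmx ((B *m E *m C)^T *m dcost2 K Z D *m AK K).
apply: (@mderiv_lyap_loop K D (fun h => rhs2 (K + h *: D) Z E) S1 (dcost2 K Z E)).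
- exact: sK.
- by move=> h; exact: rhs2_sym.
- rewrite /S1; do 2!(apply: sym_sub; last exact: symmx_sym).
  by do 2!(apply: sym_add; last exact: symmx_sym); exact: symmx_sym.
- apply: mderiv_eq.
    apply: mderivB; last exact: mderiv_feedback hZ.
    apply: mderivB; last exact: mderiv_feedback hE.
    apply: mderivD; first exact: mderiv_cst.
    by apply: mderiv_symmx; apply: mderivMr; apply: mderivMl; exact: hP.
  have alg (a b c e f : 'M[F]_n) : 0 + a - (b - c) - (e - f) = a + c + f - b - e.
    by apply/matrixP => i j; rewrite !mxE; ring.
  by rewrite alg /S1 scale0r addr0.
- by rewrite scale0r addr0.
Qed.

Lemma symmx_linear_l p a (U U' V : 'M[F]_(p, n)) (M : 'M[F]_p) :
  symmx ((a *: U + U')^T *m M *m V) =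
  a *: symmx (U^T *m M *m V) + symmx (U'^T *m M *m V).
Proof. by rewrite -symmxZ -symmxD linearP /= !mulmxDl -!scalemxAl. Qed.

Lemma symmx_linear_m p a (U V : 'M[F]_(p, n)) (M M' : 'M[F]_p) :
  symmx (U^T *m (a *: M + M') *m V) =
  a *: symmx (U^T *m M *m V) + symmx (U^T *m M' *m V).
Proof. by rewrite -symmxZ -symmxD mulmxDr mulmxDl -scalemxAr -scalemxAl. Qed.

Lemma gain_linear a (Z Z' : 'M[F]_(m, d)) :
  (a *: Z + Z') *m C = a *: (Z *m C) + Z' *m C.
Proof. by rewrite mulmxDl -scalemxAl. Qed.

Lemma loop_linear a (Z Z' : 'M[F]_(m, d)) :
  B *m (a *: Z + Z') *m C = a *: (B *m Z *m C) + B *m Z' *m C.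
Proof. by rewrite mulmxDr mulmxDl -scalemxAr -scalemxAl. Qed.

Lemma dcost1_linear K a Z Z' : dcost1 K (a *: Z + Z') = a *: dcost1 K Z + dcost1 K Z'.
Proof.
rewrite /dcost1 -lyapZ -lyapD; congr lyap.
rewrite /rhs1 (gain_linear a Z Z') (loop_linear a Z Z').
rewrite (symmx_linear_l a (Z *m C) (Z' *m C) (K *m C) R).
rewrite (symmx_linear_l a (B *m Z *m C) (B *m Z' *m C) (AK K) (cost_matrix K)).
have alg (b c e f : 'M[F]_n) : a *: b + c - (a *: e + f) = a *: (b - e) + (c - f).
  by apply/matrixP => i j; rewrite !mxE; ring.
exact: alg.
Qed.

Local Opaque cost_matrix dcost1.

Lemma dcost2C K Z E : stable (AK K) -> dcost2 K Z E = dcost2 K E Z.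
Proof.
move=> sK; rewrite /dcost2 /rhs2.
rewrite (@symmx_swap _ R (Z *m C) (E *m C) Rs).
rewrite (@symmx_swap _ (cost_matrix K) (B *m Z *m C) (B *m E *m C) (cost_matrix_sym sK)).
have alg (a b c e : 'M[F]_n) : a + b - c - e = a + b - e - c by rewrite addrAC.
exact: (congr1 (lyap (AK K)) (alg _ _ _ _)).
Qed.

Lemma dcost2_linear K E a Z Z' :
  dcost2 K (a *: Z + Z') E = a *: dcost2 K Z E + dcost2 K Z' E.
Proof.
rewrite /dcost2 -lyapZ -lyapD; congr lyap.
rewrite /rhs2 (dcost1_linear K a Z Z') (gain_linear a Z Z') (loop_linear a Z Z').
move: (dcost1 K Z) (dcost1 K Z') (dcost1 K E) (cost_matrix K) (AK K) => P1 P2 P3 P0 L.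
move: (B *m Z *m C) (B *m Z' *m C) (B *m E *m C) => V V' W.
move: (Z *m C) (Z' *m C) (E *m C) => U U' T.
rewrite !symmx_linear_l symmx_linear_m.
by apply/matrixP => i j; rewrite !mxE; ring.
Qed.

End Sensitivities.

(** * The expected cost as a trace *)

Section Expectation.
Variables (F : realType) (n : nat) (disp : measure_display).
Variables (T : measurableType disp) (P : probability T F) (x0 : T -> 'cV[F]_n).
Hypothesis x0P : square_integrable P x0.
Local Notation X0 := (second_moment P x0).

Lemma integral_qform (M : 'M[F]_n) :
  (\int[P]_w (qform M (x0 w))%:E = (\tr (M *m X0))%:E)%E.
Proof.
have [mx ix] := x0P.
have -> : (fun w => (qform M (x0 w))%:E) =
    (fun w => \sum_i \sum_j ((M i j)%:E * (x0 w i 0 * x0 w j 0)%:E))%E.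
  apply/funext => w; rewrite /qform bformE -sumEFin; apply: eq_bigr => i _.
  rewrite -sumEFin; apply: eq_bigr => j _; rewrite -EFinM; congr (_%:E).
  by ring.
rewrite integral_sum//; last first.
  by move=> i; apply: integrable_sum => // j _; exact: integrableZl.
rewrite -sumEFin; apply: eq_bigr => i _.
rewrite integral_sum//; last by move=> j; exact: integrableZl.
rewrite [(M *m X0) i i]mxE -sumEFin; apply: eq_bigr => j _.
rewrite integralZl// mxE EFinM fineK.
  rewrite unlock; congr (_ * _)%E.
  by apply: eq_integral => w _; rewrite mulrC.
by rewrite unlock; exact: integrable_fin_num.
Qed.

(** The trace against a second moment is an expectation of values of the form,
    hence monotone for the order of quadratic forms. *)
Lemma moment_ge0 (M : 'M[F]_n) : (forall x, 0 <= qform M x) -> 0 <= \tr (M *m X0).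
Proof.
move=> M0; rewrite -lee_fin -integral_qform.
by apply: integral_ge0 => w _; rewrite lee_fin.
Qed.

Lemma moment_le (M N : 'M[F]_n) : (forall x, qform M x <= qform N x) ->
  \tr (M *m X0) <= \tr (N *m X0).
Proof.
move=> h; rewrite -subr_ge0 -linearB -mulmxBl; apply: moment_ge0 => x.
by rewrite qformBm subr_ge0.
Qed.

Lemma moment_norm_le (M N : 'M[F]_n) : (forall x, `|qform M x| <= qform N x) ->
  `|\tr (M *m X0)| <= \tr (N *m X0).
Proof.
move=> h; rewrite ler_norml; apply/andP; split.
  rewrite -linearN -mulNmx; apply: moment_le => x.
  by rewrite /qform bformNm; have := h x; rewrite ler_norml => /andP[].
by apply: moment_le => x; apply: le_trans (h x); exact: ler_norm.
Qed.

Lemma trace_rank1 (u : 'cV[F]_n) (M : 'M[F]_n) : \tr (u *m u^T *m M) = qform M u.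
Proof. by rewrite -mulmxA mxtrace_mulC /mxtrace big_ord1. Qed.

Lemma qform_rank1 (u x : 'cV[F]_n) : qform (u *m u^T) x = (x^T *m u) 0 0 ^+ 2.
Proof.
rewrite /qform /bform !mulmxA -mulmxA mxE big_ord1 expr2; congr (_ * _).
have -> : u^T *m x = (x^T *m u)^T by rewrite trmx_mul trmxK.
by rewrite mxE.
Qed.

Lemma second_moment_psd : psd X0.
Proof.
split; last first.
  move=> x; rewrite -trace_rank1; apply: moment_ge0 => y.
  by rewrite qform_rank1 sqr_ge0.
apply/matrixP => i j; rewrite !mxE unlock; congr fine.
by apply: eq_integral => w _; rewrite mulrC.
Qed.

(** By Cauchy-Schwarz [M] dominates the rank-one form along [M *m v] divided by
    [qform M v].  The trace of that form against the second moment is a value of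
    [qform X0], so that no square root of [M] or [X0] is involved. *)
Lemma moment_lower (M : 'M[F]_n) mu v : psd M -> 0 <= mu ->
  (forall x, mu * sqnorm x <= qform X0 x) ->
  mu * qform M v <= \tr (M *m X0) * sqnorm v.
Proof.
move=> pM mu0 hmu; have [Ms M0] := pM.
have t0 : 0 <= \tr (M *m X0) by exact: moment_ge0.
have [q0|qn0] := eqVneq (qform M v) 0.
  by rewrite q0 mulr0 mulr_ge0 ?sqnorm_ge0.
set q := qform M v in qn0 *.
have qp : 0 < q by rewrite lt_def qn0 M0.
pose u := M *m v.
have h1 : q^-1 * qform X0 u <= \tr (M *m X0).
  rewrite -trace_rank1 -mxtraceZ scalemxAl; apply: moment_le => x.
  rewrite qformZm qform_rank1 mulrC ler_pdivrMr//.
  by have := bform_CS x v pM; rewrite /bform -mulmxA.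
have h2 : q ^+ 2 <= sqnorm v * sqnorm u.
  have -> : q = bform 1%:M v u by rewrite /bform mulmx1 /u mulmxA.
  by rewrite -!qform1; apply: bform_CS; exact: psd1.
have h3 := hmu u; have u0 := sqnorm_ge0 u; have v0 := sqnorm_ge0 v.
have h4 : mu * q <= q^-1 * (mu * sqnorm u) * sqnorm v.
  have -> : q^-1 * (mu * sqnorm u) * sqnorm v = mu * (sqnorm v * sqnorm u) / q.
    by field; rewrite gt_eqF.
  by rewrite ler_pdivlMr// -mulrA -expr2 ler_wpM2l.
apply: le_trans h4 _; rewrite ler_wpM2r//; apply: le_trans h1.
by rewrite ler_pM2l ?invr_gt0.
Qed.

End Expectation.

Section CostTrace.
Variables (F : realType) (n m d : nat) (disp : measure_display).
Variables (T : measurableType disp) (P : probability T F) (x0 : T -> 'cV[F]_n).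
Hypothesis x0P : square_integrable P x0.
Variables (A : 'M[F]_n) (B : 'M[F]_(n, m)) (C : 'M[F]_(d, n)).
Variables (Q : 'M[F]_n) (R : 'M[F]_m).
Local Notation AK := (closed_loop A B C).

Lemma stateE K x t : state A B C K x t = AK K ^+ t *m x.
Proof.
elim: t => [|t IH]; first by rewrite expr0 mul1mx.
rewrite /= IH exprS -[in RHS]mulmxA /closed_loop mulmxBl mulmxN.
by rewrite -!mulmxA.
Qed.

Lemma stage_costE K x : stage_cost C Q R K x = qform (cost_weight C Q R K) x.
Proof. by rewrite /stage_cost /qform /bform /cost_weight trmx_mul !mulmxA. Qed.

Lemma cost_trace K : stable (AK K) ->
  cost A B C Q R P x0 K = \tr (cost_matrix A B C Q R K *m second_moment P x0).
Proof.
move=> sK; rewrite /cost.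
have -> : (fun w => \sum_(0 <= t <oo)
      (stage_cost C Q R K (state A B C K (x0 w) t))%:E)%E =
    (fun w => (qform (cost_matrix A B C Q R K) (x0 w))%:E).
  apply/funext => w; apply: cvg_lim => //.
  have -> : (fun k => \sum_(0 <= t < k)
       (stage_cost C Q R K (state A B C K (x0 w) t))%:E)%E =
    (fun k => (\sum_(t < k) qform (cost_weight C Q R K) (AK K ^+ t *m x0 w))%:E).
    apply/funext => k; rewrite big_mkord -sumEFin; apply: eq_bigr => t _.
    by rewrite stage_costE stateE.
  apply: cvg_EFin; first by apply: nearW.
  exact: lyap_unfold_cvg sK (lyapE _ sK).
by rewrite integral_qform.
Qed.

End CostTrace.

(** * The Hessian of the cost *)

Section DirectionalDerivatives.
Variable F : realType.

Lemma is_derive_translate (f : F -> F) c df :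
  is_derive (0 : F) (1 : F) (fun h => f (c + h)) df -> is_derive c (1 : F) f df.
Proof.
move=> /is_derive0P h.
have e : (fun h : F => h^-1 *: ((f \o shift c) (h *: (1 : F)) - f c)) =
    (fun h => h^-1 * (f (c + h) - f (c + 0))).
  by apply/funext => t /=; rewrite addr0 [t *: 1]mulr1 [t + c]addrC.
split; first by rewrite /derivable e; apply/cvg_ex; exists df.
by rewrite /derive e; exact: cvg_lim.
Qed.

(** A directional derivative only depends on the function near the base point
    and along one line. *)
Lemma derive_line (V : normedModType F) (f : V -> F) (phi : F -> F) a v df :
  (\forall h \near (0 : F), f (a + h *: v) = phi h) ->
  is_derive (0 : F) (1 : F) phi df -> 'D_v f a = df.
Proof.
move=> fphi /is_derive0P h; apply: cvg_lim => //.
apply: cvg_trans h; apply: near_eq_cvg.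
have f0 : f a = phi 0 by have /= := nbhs_singleton fphi; rewrite scale0r addr0.
apply: filterS (nbhs_dnbhs fphi) => t /= ft.
by rewrite f0 -ft [a + _]addrC.
Qed.

Lemma unvec_line p q (w z : 'cV[F]_(q * p)) h :
  (unvec (w + h *: z) : 'M[F]_(p, q)) = unvec w + h *: unvec z.
Proof. by rewrite /unvec !linearD /= !linearZ. Qed.

Lemma unvecK p q (K : 'M[F]_(p, q)) : unvec (vec K) = K.
Proof. by rewrite /unvec /vec trmxK mxvecK trmxK. Qed.

Lemma linear_sum (U : lmodType F) p (f : 'cV[F]_p -> U) :
  (forall a x y, f (a *: x + y) = a *: f x + f y) ->
  forall x, f x = \sum_i x i 0 *: f (delta_mx i 0).
Proof.
move=> fl x.
have f0 : f 0 = 0 by have := fl (-1) 0 0; rewrite scaler0 addr0 scaleN1r addNr.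
have fs (s : seq 'I_p) : f (\sum_(i <- s) x i 0 *: delta_mx i 0) =
    \sum_(i <- s) x i 0 *: f (delta_mx i 0).
  elim: s => [|i s IH]; first by rewrite !big_nil.
  by rewrite !big_cons fl IH.
rewrite -fs; congr f; apply/colP => i; rewrite summxE (bigD1 i)//= big1.
  by rewrite !mxE !eqxx mulr1 addr0.
by move=> j ji; rewrite !mxE eq_sym (negbTE ji) mulr0.
Qed.

(** Mean value theorem for matrices, applied to each of their bilinear values. *)
Lemma spectral_norm_segment p (H H' : 'M[F]_p) 
    (phi dphi : 'cV[F]_p -> 'cV[F]_p -> F -> F) (k : F) :
  0 <= k ->
  (forall x y, bform H x y = phi x y 0) -> (forall x y, bform H' x y = phi x y 1) ->
  (forall x y (c : F), 0 <= c <= 1 -> is_derive c (1 : F) (phi x y) (dphi x y c)) ->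
  (forall (c : F) x y, 0 <= c <= 1 -> `|dphi x y c| <= k * (norm2 x * norm2 y)) ->
  spectral_norm (H - H') <= k.
Proof.
move=> k0 h0 h1 der hk; apply: spectral_norm_bform => // x y.
rewrite bformBm h0 h1.
have [||] := @MVT F (phi x y) (dphi x y) 0 1 ltr01.
- by move=> c; rewrite in_itv /= => /andP[c0 c1]; apply: der; rewrite !ltW.
- apply: derivable_within_continuous => c; rewrite in_itv /= => c01.
  by have [] := der x y c c01.
move=> c; rewrite in_itv /= => /andP[c0 c1] e.
rewrite -normrN opprB e subr0 mulr1.
by apply: hk; rewrite !ltW.
Qed.

End DirectionalDerivatives.

Section Hessian.
Local Opaque lyap cost_matrix dcost1 dcost2 dcost3.
Variables (F : realType) (n m d : nat) (disp : measure_display).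
Variables (T : measurableType disp) (P : probability T F) (x0 : T -> 'cV[F]_n).
Hypothesis x0P : square_integrable P x0.
Variables (A : 'M[F]_n) (B : 'M[F]_(n, m)) (C : 'M[F]_(d, n)).
Variables (Q : 'M[F]_n) (R : 'M[F]_m).
Hypotheses (Qs : Q^T = Q) (Rs : R^T = R).
Local Notation AK := (closed_loop A B C).
Local Notation X0 := (second_moment P x0).
Local Notation J := (cost A B C Q R P x0).
Local Notation P1 := (dcost1 A B C Q R).
Local Notation P2 := (dcost2 A B C Q R).
Local Notation P3 := (dcost3 A B C Q R).

(** Stability is an open condition; this is what allows the formula for the cost
    on stabilizing gains to be differentiated. *)
Lemma stable_line K Z : stable (AK K) ->
  \forall h \near (0 : F), stable (AK (K + h *: Z)).
Proof.
move=> sK; apply: (@stable_near F F (nbhs (0 : F)) _ n _ (AK K)) => //.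
move=> i j.
have -> : (fun h : F => AK (K + h *: Z) i j) =
    (fun h => AK K i j - h * (B *m Z *m C) i j).
  apply/funext => h; rewrite /closed_loop mulmxDr mulmxDl opprD addrA.
  by rewrite -scalemxAr -scalemxAl !mxE.
have h1 : h * (B *m Z *m C) i j @[h --> (0 : F)] --> 0 * (B *m Z *m C) i j.
  by apply: cvgM; [exact: cvg_id|exact: cvg_cst].
rewrite mul0r in h1.
have h2 : AK K i j @[_ --> (0 : F)] --> AK K i j by exact: cvg_cst.
by have := cvgB h2 h1; rewrite subr0; exact.
Qed.

Local Notation Jv := (fun v => J (unvec v)).

Lemma derive_cost w z : stable (AK (unvec w)) ->
  'D_z Jv w = \tr (P1 (unvec w) (unvec z) *m X0).
Proof.
move=> sw.
apply: (derive_line _ (mderiv_trace X0 (mderiv_cost_matrix Qs Rs (E := unvec z) sw))).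
apply: filterS (stable_line (unvec z) sw) => h sh.
by rewrite unvec_line cost_trace.
Qed.

Lemma derive2_cost w z z' : stable (AK (unvec w)) ->
  'D_z (fun v => 'D_z' Jv v) w = \tr (P2 (unvec w) (unvec z') (unvec z) *m X0).
Proof.
move=> sw.
apply: (derive_line _ (mderiv_trace X0 (mderiv_dcost1 Qs Rs (Z := unvec z') (E := unvec z) sw))).
apply: filterS (stable_line (unvec z) sw) => h sh.
by rewrite derive_cost unvec_line.
Qed.

Lemma bform_hessian K x y : stable (AK K) ->
  bform (hessian Jv (vec K)) x y = \tr (P2 K (unvec x) (unvec y) *m X0).
Proof.
move=> sK; pose f u v : F^o := \tr (P2 K (unvec u) (unvec v) *m X0).
have fl v a u u' : f (a *: u + u') v = a *: f u v + f u' v.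
  rewrite /f addrC unvec_line addrC dcost2_linear mulmxDl -scalemxAl.
  by rewrite linearD linearZ.
have fC u v : f u v = f v u by rewrite /f dcost2C.
rewrite bformE -[RHS]/(f x y) (linear_sum (fl y)); apply: eq_bigr => i _.
rewrite fC (linear_sum (fl _)) scaler_sumr; apply: eq_bigr => j _.
rewrite mxE derive2_cost unvecK// /f -mulrA; congr (_ * _).
by rewrite mulrC.
Qed.

Lemma is_derive_dcost2 K E Z Z' c : stable (AK (K + c *: E)) ->
  is_derive c (1 : F) (fun t => \tr (P2 (K + t *: E) Z Z' *m X0))
    (\tr (P3 (K + c *: E) Z Z' E *m X0)).
Proof.
move=> sc; apply: is_derive_translate.
have h : mderiv (fun h => P2 (K + (c + h) *: E) Z Z') (P3 (K + c *: E) Z Z' E).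
  have h0 : mderiv (fun h => P2 (K + c *: E + h *: E) Z Z') (P3 (K + c *: E) Z Z' E).
    exact: mderiv_dcost2.
  by apply: (mderiv_ext _ h0) => t; rewrite scalerDl addrA.
exact: (mderiv_trace X0 h).
Qed.

Lemma hessian_lipschitz_segment K K' k : 0 <= k ->
  (forall c, 0 <= c <= 1 -> stable (AK (K + c *: (K' - K)))) ->
  (forall c x y, 0 <= c <= 1 ->
    `|\tr (P3 (K + c *: (K' - K)) (unvec x) (unvec y) (K' - K) *m X0)|
      <= k * (norm2 x * norm2 y)) ->
  spectral_norm (hessian Jv (vec K) - hessian Jv (vec K')) <= k.
Proof.
move=> k0 sc hc.
have E0 : K = K + 0 *: (K' - K) by rewrite scale0r addr0.
have E1 : K' = K + 1 *: (K' - K) by rewrite scale1r addrC subrK.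
have s0 : stable (AK K) by rewrite E0; apply: sc; rewrite lexx ler01.
have s1 : stable (AK K') by rewrite E1; apply: sc; rewrite lexx ler01.
apply: (@spectral_norm_segment _ _ _ _
  (fun x y t => \tr (P2 (K + t *: (K' - K)) (unvec x) (unvec y) *m X0))
  (fun x y t => \tr (P3 (K + t *: (K' - K)) (unvec x) (unvec y) (K' - K) *m X0))).
- exact: k0.
- move=> x y; apply: etrans (bform_hessian _ _ s0) _.
  exact: (congr1 (fun L => \tr (P2 L (unvec x) (unvec y) *m X0)) E0).
- move=> x y; apply: etrans (bform_hessian _ _ s1) _.
  exact: (congr1 (fun L => \tr (P2 L (unvec x) (unvec y) *m X0)) E1).
- by move=> x y c c01; apply: is_derive_dcost2; exact: sc.
- exact: hc.
Qed.

End Hessian.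

(** * Bounds on the derivatives of the cost matrix *)

Section Bounds.
Variables (F : realType) (n m d : nat).
Variables (A : 'M[F]_n) (B : 'M[F]_(n, m)) (C : 'M[F]_(d, n)).
Variables (Q : 'M[F]_n) (R : 'M[F]_m).
Local Opaque lyap cost_matrix dcost1 dcost2 dcost3.

Lemma qform_spectral k (M : 'M[F]_k) x : `|qform M x| <= spectral_norm M * sqnorm x.
Proof.
have -> : qform M x = (x^T *m (M *m x)) 0 0 by rewrite /qform /bform mulmxA.
apply: le_trans (dot_CS _ _) _; rewrite mulrC -norm2E expr2 mulrA.
by rewrite ler_wpM2r ?norm2_ge0// norm2_mul.
Qed.

(** [bform_young] with parameter the inverse of [a]. *)
Lemma young_scaled k (V : 'M[F]_k) x y (a X : F) : psd V -> 0 <= a -> 0 <= X ->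
  qform V x <= a ^+ 2 * X -> 2 * `|bform V x y| <= a * (X + qform V y).
Proof.
move=> pV a0 X0 hx; have [_ V0] := pV; have qy := V0 y.
have [az|an] := eqVneq a 0.
  have := bform_CS x y pV; move: hx; rewrite az expr0n /= !mul0r => hx.
  have -> : qform V x = 0 by apply/le_anti; rewrite hx V0.
  rewrite mul0r => h; have /eqP : bform V x y ^+ 2 = 0.
    by apply/le_anti; rewrite h sqr_ge0.
  by rewrite sqrf_eq0 => /eqP ->; rewrite normr0 mulr0.
have ap : 0 < a by rewrite lt_def an.
have := @bform_young F k V x y a^-1 pV; rewrite invr_gt0 => /(_ ap) /le_trans; apply.
rewrite invrK mulrDr lerD2r -ler_pdivlMl ?invr_gt0// invrK.
by rewrite mulrA -expr2.
Qed.

Lemma double_mul_le (u v : F) : 2 * (u * v) <= u ^+ 2 + v ^+ 2.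
Proof. by have := sqr_ge0 (u - v); rewrite sqrrB; lra. Qed.

Lemma ler_norm4 (a b c e a' b' c' e' : F) :
  `|a| <= a' -> `|b| <= b' -> `|c| <= c' -> `|e| <= e' ->
  `|2 * a + 2 * b - 2 * c - 2 * e| <= 2 * a' + 2 * b' + 2 * c' + 2 * e'.
Proof.
rewrite !ler_norml => /andP[? ?] /andP[? ?] /andP[? ?] /andP[? ?].
by apply/andP; split; lra.
Qed.

Lemma ler_norm6 (a b c e f g a' b' c' e' f' g' : F) :
  `|a| <= a' -> `|b| <= b' -> `|c| <= c' ->
  `|e| <= e' -> `|f| <= f' -> `|g| <= g' ->
  `|2 * a + 2 * b + 2 * c - 2 * e - 2 * f - 2 * g| <=
    2 * a' + 2 * b' + 2 * c' + 2 * e' + 2 * f' + 2 * g'.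
Proof.
rewrite !ler_norml => /andP[? ?] /andP[? ?] /andP[? ?].
by move=> /andP[? ?] /andP[? ?] /andP[? ?]; apply/andP; split; lra.
Qed.

(** In this section [p], [g], [sQ] and [q] stand for [alpha / mu], [gamma],
    [sigma_min Q] and [q3]; then [z1] and [z2] below are [zeta1] and [zeta2]. *)
Section AtGain.
Variables (K : 'M[F]_(m, d)) (p g sQ : F).
Local Notation AK := (closed_loop A B C K).
Local Notation W := (cost_weight C Q R K).
Local Notation P0 := (cost_matrix A B C Q R K).
Local Notation P1 := (dcost1 A B C Q R K).
Local Notation P2 := (dcost2 A B C Q R K).
Local Notation P3 := (dcost3 A B C Q R K).
Local Notation nB := (spectral_norm B).
Local Notation nC := (spectral_norm C).
Local Notation nR := (spectral_norm R).

Hypotheses (sK : stable AK) (pQ : psd Q) (pR : psd R) (sQ0 : 0 < sQ) (sQp : sQ <= p).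
Hypothesis hQ : forall x, sQ * sqnorm x <= qform Q x.
Hypothesis hp : forall x, qform P0 x <= p * sqnorm x.
Hypotheses (g0 : 0 <= g) (hg : forall x, norm2 (AK *m x) <= g * norm2 x).

Let p0 : 0 < p. Proof. exact: lt_le_trans sQp. Qed.
Let nB0 : 0 <= nB. Proof. exact: spectral_norm_ge0. Qed.
Let nC0 : 0 <= nC. Proof. exact: spectral_norm_ge0. Qed.
Let nR0 : 0 <= nR. Proof. exact: spectral_norm_ge0. Qed.

Lemma qform_weight x : qform W x = qform Q x + qform R (K *m C *m x).
Proof. by rewrite /cost_weight qformDm qform_mul. Qed.

Lemma weight_lower x : sQ * sqnorm x <= qform W x.
Proof. by rewrite qform_weight; have [_ /(_ (K *m C *m x))] := pR; have := hQ x; lra. Qed.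

Lemma weight_ge0 x : 0 <= qform W x.
Proof. by apply: le_trans (weight_lower x); rewrite mulr_ge0 ?sqnorm_ge0// ltW. Qed.

Lemma cost_matrixE : P0 = W + AK^T *m P0 *m AK.
Proof. by rewrite -lyapE. Qed.

Lemma qform_cost x : qform P0 x = qform W x + qform P0 (AK *m x).
Proof. by rewrite {1}cost_matrixE qformDm qform_mul. Qed.

Lemma cost_psd : psd P0.
Proof.
split; first by apply: cost_matrix_sym sK; [case: pQ|case: pR].
move=> x; apply: le_trans (weight_ge0 x) _.
by apply: (lyap_ge0 sK) => y; exact: weight_ge0.
Qed.

Definition contracts nu (Z : 'M[F]_(m, d)) := forall x, norm2 (Z *m x) <= nu * norm2 x.

Lemma norm_gain nu Z x : 0 <= nu -> contracts nu Z ->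
  norm2 (Z *m C *m x) <= nu * nC * norm2 x.
Proof.
move=> nu0 hZ; rewrite -mulmxA; apply: le_trans (hZ _) _.
by rewrite -mulrA ler_wpM2l// norm2_mul.
Qed.

Lemma norm_loop nu Z x : 0 <= nu -> contracts nu Z ->
  norm2 (B *m Z *m C *m x) <= nu * (nB * nC) * norm2 x.
Proof.
move=> nu0 hZ; rewrite -!mulmxA; apply: le_trans (norm2_mul _ _) _.
have -> : nu * (nB * nC) * norm2 x = nB * (nu * nC * norm2 x) by ring.
by rewrite ler_wpM2l// mulmxA norm_gain.
Qed.

Lemma sq_norm_le q (y : 'cV[F]_q) (a : F) : norm2 y <= a -> sqnorm y <= a ^+ 2.
Proof.
move=> h; rewrite -norm2E lerXn2r ?nnegrE ?norm2_ge0//.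
by apply: le_trans h; exact: norm2_ge0.
Qed.

Lemma qform_rhs1 Z x : qform (rhs1 A B C Q R K Z) x =
  2 * bform R (Z *m C *m x) (K *m C *m x)
  - 2 * bform P0 (B *m Z *m C *m x) (AK *m x).
Proof. by rewrite /rhs1 qformBm !qform_symmx !qform_mul. Qed.

Lemma qR_gain nu Z x : 0 <= nu -> contracts nu Z ->
  qform R (Z *m C *m x) <= nu ^+ 2 * (nC ^+ 2 * nR * sqnorm x).
Proof.
move=> nu0 hZ; apply: le_trans (ler_norm _) (le_trans (qform_spectral _ _) _).
have := ler_wpM2l nR0 (sq_norm_le (norm_gain x nu0 hZ)).
by move=> /le_trans; apply; rewrite !exprMn norm2E le_eqVlt; apply/orP; left; apply/eqP; ring.
Qed.

Lemma qP_loop nu Z x : 0 <= nu -> contracts nu Z ->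
  qform P0 (B *m Z *m C *m x) <= nu ^+ 2 * ((nB * nC) ^+ 2 * p * sqnorm x).
Proof.
move=> nu0 hZ; apply: le_trans (hp _) _.
have := ler_wpM2l (ltW p0) (sq_norm_le (norm_loop x nu0 hZ)).
by move=> /le_trans; apply; rewrite !exprMn norm2E le_eqVlt; apply/orP; left; apply/eqP; ring.
Qed.

Local Notation z1 := (sQ^-1 * ((1 + nC ^+ 2 * nB ^+ 2) * p + nC ^+ 2 * nR) - 1).

Lemma z1_ge0 : 0 <= z1.
Proof.
rewrite subr_ge0 -ler_pdivrMl ?invr_gt0// invrK mulr1 mulrDl mul1r -addrA.
apply: le_trans sQp _; rewrite lerDl addr_ge0// ?mulr_ge0 ?sqr_ge0//.
exact: ltW.
Qed.

(** Each of the two terms of [rhs1] pairs a variation with one of the two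
    summands of [qform P0 x - qform Q x], namely [qform R (K *m C *m x)] and
    [qform P0 (AK *m x)].  By the inequality of arithmetic and geometric means
    the variations contribute [nC ^+ 2 * nR] and [(nB * nC) ^+ 2 * p], the
    summands at most [p - sQ]. *)
Lemma rhs1_bound1 nu Z x : 0 <= nu -> contracts nu Z ->
  `|qform (rhs1 A B C Q R K Z) x| <= nu * z1 * qform W x.
Proof.
move=> nu0 hZ; rewrite qform_rhs1; have s0 := sqnorm_ge0 x.
have X1 : 0 <= nC ^+ 2 * nR * sqnorm x by rewrite !mulr_ge0// sqr_ge0.
have X2 : 0 <= (nB * nC) ^+ 2 * p * sqnorm x.
  by rewrite !mulr_ge0 ?sqr_ge0// ltW.
have h1 := young_scaled (K *m C *m x) pR nu0 X1 (qR_gain x nu0 hZ).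
have h2 := young_scaled (AK *m x) cost_psd nu0 X2 (qP_loop x nu0 hZ).
apply: le_trans (ler_normB _ _) _; rewrite !normrM !(@ger0_norm _ 2)//.
apply: le_trans (lerD h1 h2) _; rewrite -mulrDr -[leRHS]mulrA ler_wpM2l//.
have e1 := qform_cost x; have e2 := qform_weight x.
have h3 := hQ x; have h4 := hp x; have h5 := weight_lower x.
apply: (@le_trans _ _ (z1 * (sQ * sqnorm x))); last first.
  by rewrite ler_wpM2l// z1_ge0.
have -> : z1 * (sQ * sqnorm x) =
    ((1 + nC ^+ 2 * nB ^+ 2) * p + nC ^+ 2 * nR) * sqnorm x - sQ * sqnorm x.
  by field; rewrite gt_eqF.
have -> : ((1 + nC ^+ 2 * nB ^+ 2) * p + nC ^+ 2 * nR) * sqnorm x =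
    nC ^+ 2 * nR * sqnorm x + (nB * nC) ^+ 2 * p * sqnorm x + p * sqnorm x by ring.
by move: h1 h2 X1 X2 => _ _ _ _; lra.
Qed.

(** Used with [t = g], the norm of the closed loop, and with [t = 1], since the
    closed loop does not increase [P0]. *)
Lemma bform_loop_bound nu Z x (t : F) : 0 <= nu -> contracts nu Z -> 0 <= t ->
  qform P0 (AK *m x) <= p * t ^+ 2 * sqnorm x ->
  `|bform P0 (B *m Z *m C *m x) (AK *m x)| <= nu * (nB * nC * p) * t * sqnorm x.
Proof.
move=> nu0 hZ t0 ht; have s0 := sqnorm_ge0 x.
have r0 : 0 <= nu * (nB * nC * p) * t * sqnorm x.
  by rewrite !mulr_ge0// ltW.
rewrite -ler_sqr ?nnegrE// real_normK ?num_real//.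
apply: le_trans (bform_CS _ _ cost_psd) _.
apply: (@le_trans _ _ (nu ^+ 2 * ((nB * nC) ^+ 2 * p * sqnorm x) * (p * t ^+ 2 * sqnorm x))).
  have [_ Pp] := cost_psd.
  by rewrite ler_pM ?Pp// qP_loop.
by rewrite le_eqVlt; apply/orP; left; apply/eqP; ring.
Qed.

Variable q : F.
Hypothesis hq : 3 / 4 * (nC * Num.sqrt (nR * p)) + 1 / 2 * (nC * nB * p) <= nC * nR * q.
Local Notation z2 := (2 / sQ * (nC * nR * q + g * nC * nB * p)).

(** The factor [2 / 3] is what [sens3_le] needs.  It is gained on the term in
    [R] because this term can be compared with the two summands of [W], and on
    the feedback term because [bform_loop_bound] holds both for [t = g] and for
    [t = 1]: a mean of the two bounds with weights [1 / 3] and [2 / 3] is used. *)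
Lemma rhs1_bound2 nu Z x : 0 <= nu -> contracts nu Z ->
  `|qform (rhs1 A B C Q R K Z) x| <= nu * (2 / 3 * z2) * qform W x.
Proof.
move=> nu0 hZ; rewrite qform_rhs1; have s0 := sqnorm_ge0 x.
(* [s ^+ 2 * sQ] is [nC ^+ 2 * nR * (p / sQ)], hence at least [nC ^+ 2 * nR]. *)
pose s := nC * Num.sqrt (nR * p) / sQ.
have s1 : 0 <= s by rewrite divr_ge0 ?mulr_ge0 ?sqrtr_ge0// ltW.
have nus : 0 <= nu * s by rewrite mulr_ge0.
have X1 : 0 <= sQ * sqnorm x by rewrite mulr_ge0// ltW.
have h0 : qform R (Z *m C *m x) <= (nu * s) ^+ 2 * (sQ * sqnorm x).
  apply: le_trans (qR_gain x nu0 hZ) _; rewrite exprMn -[leRHS]mulrA ler_wpM2l ?sqr_ge0//.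
  have -> : s ^+ 2 * (sQ * sqnorm x) = nC ^+ 2 * nR * sqnorm x * (p / sQ).
    rewrite /s !exprMn sqr_sqrtr ?mulr_ge0 ?(ltW p0)//.
    by field; rewrite gt_eqF.
  rewrite ler_peMr//; first by rewrite !mulr_ge0// sqr_ge0.
  by rewrite ler_pdivlMr// mul1r.
have h1 := young_scaled (K *m C *m x) pR nus X1 h0.
have e1 := qform_cost x; have e2 := qform_weight x; have h3 := hQ x.
have wx := weight_ge0 x; have ww := weight_lower x.
have Pp : psd P0 by exact: cost_psd.
have b1 : `|bform P0 (B *m Z *m C *m x) (AK *m x)| <= nu * (nB * nC * p) * 1 * sqnorm x.
  apply: bform_loop_bound => //; rewrite expr1n mulr1.
  by have := hp x; lra.
have bg : `|bform P0 (B *m Z *m C *m x) (AK *m x)| <= nu * (nB * nC * p) * g * sqnorm x.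
  apply: bform_loop_bound => //; apply: le_trans (hp _) _.
  rewrite -[leRHS]mulrA ler_wpM2l ?(ltW p0)//.
  by have := sq_norm_le (hg x); rewrite exprMn norm2E.
apply: le_trans (ler_normB _ _) _; rewrite !normrM !(@ger0_norm _ 2)//.
have r1 : 2 * `|bform R (Z *m C *m x) (K *m C *m x)| <= nu * s * qform W x.
  by apply: le_trans h1 _; rewrite ler_wpM2l// e2 lerD2r.
pose k := nB * nC * p * (2 / 3 + 4 / 3 * g) / sQ.
have k0 : 0 <= k.
  by rewrite /k !mulr_ge0 ?invr_ge0 ?(ltW p0) ?(ltW sQ0)// addr_ge0 ?mulr_ge0 ?invr_ge0.
have r2 : 2 * `|bform P0 (B *m Z *m C *m x) (AK *m x)| <= nu * k * qform W x.
  apply: (@le_trans _ _ (nu * k * (sQ * sqnorm x))); last first.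
    by rewrite ler_wpM2l// mulr_ge0.
  have -> : nu * k * (sQ * sqnorm x) = 2 / 3 * (nu * (nB * nC * p) * 1 * sqnorm x)
      + 4 / 3 * (nu * (nB * nC * p) * g * sqnorm x).
    by rewrite /k; field; rewrite gt_eqF.
  by move: b1 bg; lra.
apply: le_trans (lerD r1 r2) _.
rewrite -mulrDl -mulrDr ler_wpM2r// ler_wpM2l//.
have -> : 2 / 3 * z2 = (4 / 3 * (nC * nR * q) + 4 / 3 * (g * nC * nB * p)) / sQ.
  by field; rewrite gt_eqF.
rewrite /s /k -mulrDl ler_wpM2r ?invr_ge0 ?(ltW sQ0)//.
have := hq; set u := nC * _; set v := nC * nR * q.
have -> : nB * nC * p * (2 / 3 + 4 / 3 * g) =
   2 / 3 * (nC * nB * p) + 4 / 3 * (g * nC * nB * p) by ring.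
lra.
Qed.

(** The first and second derivatives of the cost matrix in unit directions are
    bounded by [sens1 * p] and [sens2 * p], the third by
    [sens3 *: lyap AK 1%:M]. *)
Definition sens1 : F := Num.min z1 (2 / 3 * z2).

Lemma sens1_ge0 : 0 <= sens1.
Proof.
rewrite le_min z1_ge0 /= mulr_ge0// ?divr_ge0// mulr_ge0 ?divr_ge0 ?(ltW sQ0)//.
rewrite addr_ge0//; last by rewrite !mulr_ge0// ltW.
apply: le_trans hq; rewrite addr_ge0// mulr_ge0 ?divr_ge0//.
  by rewrite mulr_ge0// sqrtr_ge0.
by rewrite !mulr_ge0// ltW.
Qed.

Lemma dcost1_bound nu Z x : 0 <= nu -> contracts nu Z ->
  `|qform (P1 Z) x| <= nu * sens1 * p * sqnorm x.
Proof.
move=> nu0 hZ.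
have h y : `|qform (rhs1 A B C Q R K Z) y| <= qform ((nu * sens1) *: W) y.
  rewrite qformZm /sens1; case: (leP z1 (2 / 3 * z2)) => _.
    exact: rhs1_bound1.
  exact: rhs1_bound2.
apply: le_trans (lyap_norm_le sK h x) _.
rewrite lyapZ qformZm -[X in _ <= X]mulrA ler_wpM2l ?mulr_ge0 ?sens1_ge0//.
Qed.

Fact sens2_key : unit. Proof. by []. Qed.
Definition sens2 : F := locked_with sens2_key
  (2 / sQ * (nC ^+ 2 * nR + nB * nC * (nB * nC + 2 * sens1 * g) * p)).

Lemma sens2E : sens2 =
  2 / sQ * (nC ^+ 2 * nR + nB * nC * (nB * nC + 2 * sens1 * g) * p).
Proof. by rewrite /sens2 unlock. Qed.

Lemma sens2_ge0 : 0 <= sens2.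
Proof.
have z0 := sens1_ge0; have pp := ltW p0.
by rewrite sens2E !(mulr_ge0, addr_ge0, invr_ge0, sqr_ge0)// ltW.
Qed.

Lemma qform_rhs2 Z E x : qform (rhs2 A B C Q R K Z E) x =
  2 * bform R (Z *m C *m x) (E *m C *m x)
  + 2 * bform P0 (B *m Z *m C *m x) (B *m E *m C *m x)
  - 2 * bform (P1 E) (B *m Z *m C *m x) (AK *m x)
  - 2 * bform (P1 Z) (B *m E *m C *m x) (AK *m x).
Proof.
rewrite /rhs2; move: (P1 E) (P1 Z) P0 AK => N1 N2 N0 L.
move: (B *m Z *m C) (B *m E *m C) (Z *m C) (E *m C) => V V' U U'.
by rewrite !qformBm qformDm !qform_symmx !qform_mul.
Qed.

Lemma bform_le k (N : 'M[F]_k) (c a b : F) u v : N^T = N -> 0 <= c ->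
  (forall y, `|qform N y| <= c * sqnorm y) -> norm2 u <= a -> norm2 v <= b ->
  `|bform N u v| <= c * (a * b).
Proof.
move=> Ns c0 hN hu hv; apply: le_trans (bform_bound u v Ns hN) _.
by rewrite ler_wpM2l// ler_pM ?norm2_ge0.
Qed.

Lemma dcost2_bound nu Z eta E x : 0 <= nu -> contracts nu Z ->
  0 <= eta -> contracts eta E ->
  `|qform (P2 Z E) x| <= nu * eta * sens2 * p * sqnorm x.
Proof.
move=> nu0 hZ eta0 hE; have z0 := sens1_ge0; have pp := ltW p0.
have [Qs _] := pQ; have [Rs _] := pR; have [Ps Pp] := cost_psd.
have h y : `|qform (rhs2 A B C Q R K Z E) y| <= qform ((nu * eta * sens2) *: W) y.
  rewrite qform_rhs2 qformZm.
  have y0 := norm2_ge0 y.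
  have hR : `|bform R (Z *m C *m y) (E *m C *m y)| <=
      nR * ((nu * nC * norm2 y) * (eta * nC * norm2 y)).
    by apply: bform_le; rewrite ?norm_gain// => w; exact: qform_spectral.
  have hP : `|bform P0 (B *m Z *m C *m y) (B *m E *m C *m y)| <=
      p * ((nu * (nB * nC) * norm2 y) * (eta * (nB * nC) * norm2 y)).
    by apply: bform_le; rewrite ?norm_loop// => w; rewrite ger0_norm.
  have h1 : `|bform (P1 E) (B *m Z *m C *m y) (AK *m y)| <=
      eta * sens1 * p * ((nu * (nB * nC) * norm2 y) * (g * norm2 y)).
    apply: bform_le; rewrite ?norm_loop ?dcost1_sym ?mulr_ge0// => w.
    exact: dcost1_bound.
  have h2 : `|bform (P1 Z) (B *m E *m C *m y) (AK *m y)| <=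
      nu * sens1 * p * ((eta * (nB * nC) * norm2 y) * (g * norm2 y)).
    apply: bform_le; rewrite ?norm_loop ?dcost1_sym ?mulr_ge0// => w.
    exact: dcost1_bound.
  apply: (@le_trans _ _ (nu * eta * sens2 * (sQ * sqnorm y))); last first.
    by rewrite ler_wpM2l ?weight_lower// !mulr_ge0// sens2_ge0.
  have -> : nu * eta * sens2 * (sQ * sqnorm y) =
      2 * (nR * ((nu * nC * norm2 y) * (eta * nC * norm2 y)))
    + 2 * (p * ((nu * (nB * nC) * norm2 y) * (eta * (nB * nC) * norm2 y)))
    + 2 * (eta * sens1 * p * ((nu * (nB * nC) * norm2 y) * (g * norm2 y)))
    + 2 * (nu * sens1 * p * ((eta * (nB * nC) * norm2 y) * (g * norm2 y))).
    by rewrite sens2E -norm2E; field; rewrite gt_eqF.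
  exact: ler_norm4 hR hP h1 h2.
apply: le_trans (lyap_norm_le sK h x) _.
rewrite lyapZ qformZm -[X in _ <= X]mulrA ler_wpM2l ?hp// !mulr_ge0// sens2_ge0//.
Qed.

Lemma qform_rhs3 Z E D x : qform (rhs3 A B C Q R K Z E D) x =
  2 * bform (P1 D) (B *m Z *m C *m x) (B *m E *m C *m x)
  + 2 * bform (P1 E) (B *m Z *m C *m x) (B *m D *m C *m x)
  + 2 * bform (P1 Z) (B *m E *m C *m x) (B *m D *m C *m x)
  - 2 * bform (P2 E D) (B *m Z *m C *m x) (AK *m x)
  - 2 * bform (P2 Z D) (B *m E *m C *m x) (AK *m x)
  - 2 * bform (P2 Z E) (B *m D *m C *m x) (AK *m x).
Proof.
rewrite /rhs3; move: (P1 D) (P1 E) (P1 Z) (P2 E D) (P2 Z D) (P2 Z E) AK.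
move: (B *m Z *m C) (B *m E *m C) (B *m D *m C) => V V' V'' N1 N2 N3 N4 N5 N6 L.
by rewrite 3!qformBm 2!qformDm !qform_symmx !qform_mul.
Qed.

Definition sens3 : F := 6 * (nB * nC) * p * (nB * nC * sens1 + sens2).

Lemma sens3_ge0 : 0 <= sens3.
Proof.
have z0 := sens1_ge0; have zz0 := sens2_ge0; have pp := ltW p0.
by rewrite /sens3 !(mulr_ge0, addr_ge0).
Qed.

(** In the last three terms of [rhs3] the closed loop is estimated by
    [2 * norm2 x * norm2 (AK *m x) <= sqnorm x + sqnorm (AK *m x)].  As
    [lyap AK (1 + AK^T *m AK)] is at most twice [lyap AK 1], these terms cost no
    factor [g]. *)
Lemma dcost3_bound nu Z eta E th D x : 0 <= nu -> contracts nu Z ->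
  0 <= eta -> contracts eta E -> 0 <= th -> contracts th D ->
  `|qform (P3 Z E D) x| <= nu * eta * th * sens3 * qform (lyap AK 1%:M) x.
Proof.
move=> nu0 hZ eta0 hE th0 hD; have z0 := sens1_ge0; have zz0 := sens2_ge0.
have pp := ltW p0; have [Qs _] := pQ; have [Rs _] := pR.
pose b := nB * nC; have b0 : 0 <= b by rewrite mulr_ge0.
pose k1 := nu * eta * th * (6 * b * p * (b * sens1)).
pose k2 := nu * eta * th * (3 * b * p * sens2).
have k20 : 0 <= k2 by rewrite /k2 !mulr_ge0.
pose N := k1 *: 1%:M + k2 *: (1%:M + AK^T *m 1%:M *m AK).
have h y : `|qform (rhs3 A B C Q R K Z E D) y| <= qform N y.
  rewrite qform_rhs3 /N qformDm !qformZm qformDm qform_mul !qform1.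
  rewrite -/(qform 1%:M (AK *m y)) qform1.
  have y0 := norm2_ge0 y.
  have c1 : `|bform (P1 D) (B *m Z *m C *m y) (B *m E *m C *m y)| <=
      th * sens1 * p * ((nu * b * norm2 y) * (eta * b * norm2 y)).
    apply: bform_le; rewrite ?norm_loop ?dcost1_sym ?mulr_ge0// => w.
    exact: dcost1_bound.
  have c2 : `|bform (P1 E) (B *m Z *m C *m y) (B *m D *m C *m y)| <=
      eta * sens1 * p * ((nu * b * norm2 y) * (th * b * norm2 y)).
    apply: bform_le; rewrite ?norm_loop ?dcost1_sym ?mulr_ge0// => w.
    exact: dcost1_bound.
  have c3 : `|bform (P1 Z) (B *m E *m C *m y) (B *m D *m C *m y)| <=
      nu * sens1 * p * ((eta * b * norm2 y) * (th * b * norm2 y)).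
    apply: bform_le; rewrite ?norm_loop ?dcost1_sym ?mulr_ge0// => w.
    exact: dcost1_bound.
  have c4 : `|bform (P2 E D) (B *m Z *m C *m y) (AK *m y)| <=
      eta * th * sens2 * p * ((nu * b * norm2 y) * norm2 (AK *m y)).
    apply: bform_le; rewrite ?norm_loop ?dcost2_sym ?mulr_ge0// => w.
    exact: dcost2_bound.
  have c5 : `|bform (P2 Z D) (B *m E *m C *m y) (AK *m y)| <=
      nu * th * sens2 * p * ((eta * b * norm2 y) * norm2 (AK *m y)).
    apply: bform_le; rewrite ?norm_loop ?dcost2_sym ?mulr_ge0// => w.
    exact: dcost2_bound.
  have c6 : `|bform (P2 Z E) (B *m D *m C *m y) (AK *m y)| <=
      nu * eta * sens2 * p * ((th * b * norm2 y) * norm2 (AK *m y)).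
    apply: bform_le; rewrite ?norm_loop ?dcost2_sym ?mulr_ge0// => w.
    exact: dcost2_bound.
  apply: (@le_trans _ _ (k1 * sqnorm y + k2 * (2 * (norm2 y * norm2 (AK *m y))))).
    have -> : k1 * sqnorm y + k2 * (2 * (norm2 y * norm2 (AK *m y))) =
       2 * (th * sens1 * p * ((nu * b * norm2 y) * (eta * b * norm2 y)))
     + 2 * (eta * sens1 * p * ((nu * b * norm2 y) * (th * b * norm2 y)))
     + 2 * (nu * sens1 * p * ((eta * b * norm2 y) * (th * b * norm2 y)))
     + 2 * (eta * th * sens2 * p * ((nu * b * norm2 y) * norm2 (AK *m y)))
     + 2 * (nu * th * sens2 * p * ((eta * b * norm2 y) * norm2 (AK *m y)))
     + 2 * (nu * eta * sens2 * p * ((th * b * norm2 y) * norm2 (AK *m y))).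
      by rewrite /k1 /k2 -norm2E; ring.
    exact: ler_norm6 c1 c2 c3 c4 c5 c6.
  rewrite lerD2l ler_wpM2l// -!norm2E.
  exact: double_mul_le.
apply: le_trans (lyap_norm_le sK h x) _.
have e : lyap AK (AK^T *m 1%:M *m AK) = lyap AK 1%:M - 1%:M.
  apply/esym; apply: lyap_uniq => //.
  move: (lyapE 1%:M sK); move: (lyap AK 1%:M) AK => Y L eY.
  by rewrite mulmxBr mulmxBl [RHS]addrC subrK {1}eY addrC addKr.
rewrite /N lyapD !lyapZ lyapD e qformDm !qformZm qformDm qformBm qform1.
have s0 := sqnorm_ge0 x.
rewrite -subr_ge0; set Y := qform _ x.
have -> : nu * eta * th * sens3 * Y - (k1 * Y + k2 * (Y + (Y - sqnorm x))) = k2 * sqnorm x.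
  by rewrite /sens3 /k1 /k2 -/b; ring.
by rewrite mulr_ge0.
Qed.

(** The left-hand side contains [sens1 * g] six times, the right-hand side
    [(3 * z1 + 2 * z2) * g]; [sens1 <= z1] and [sens1 <= 2 / 3 * z2] bound three
    of the six occurrences each. *)
Lemma sens3_le z3 z4 :
  z3 = 2 / sQ * (nC ^+ 2 * nR
    + nC * nB * (nC * nB + z1 * g + z2 * g) * p) ->
  z4 = 2 / sQ * (nC ^+ 2 * nR + nC * nB * (nC * nB + z1 * g) * p) ->
  sens3 <= 2 * p * nB * nC * ((2 * z1 + z2) * nB * nC + 2 * z3 + z4).
Proof.
have h1 : sens1 <= z1 by rewrite ge_min lexx.
have h2 : sens1 <= 2 / 3 * z2 by rewrite ge_min lexx orbT.
have z0 := sens1_ge0.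
set a1 := z1 in h1 *; set a2 := z2 in h2 *; move=> -> ->.
have b0 : 0 <= nB * nC by rewrite mulr_ge0.
have -> : sens3 = 2 * p * nB * nC * (3 * (nB * nC) * sens1 + 3 * sens2).
  by rewrite /sens3; ring.
have pp := ltW p0.
rewrite ler_wpM2l ?mulr_ge0//.
have e : (2 * a1 + a2) * nB * nC + 2 * (2 / sQ * (nC ^+ 2 * nR
      + nC * nB * (nC * nB + a1 * g + a2 * g) * p))
    + 2 / sQ * (nC ^+ 2 * nR + nC * nB * (nC * nB + a1 * g) * p) =
   nB * nC * (2 * a1 + a2)
   + (2 / sQ * (3 * (nC ^+ 2 * nR + (nB * nC) ^+ 2 * p)) +
      2 / sQ * (nB * nC * p * g) * (3 * a1 + 2 * a2)).
  by ring.
have e' : 3 * (nB * nC) * sens1 + 3 * sens2 =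
   nB * nC * (3 * sens1) + (2 / sQ * (3 * (nC ^+ 2 * nR + (nB * nC) ^+ 2 * p)) +
      2 / sQ * (nB * nC * p * g) * (6 * sens1)).
  by rewrite sens2E; ring.
rewrite e e' lerD//; first by rewrite ler_wpM2l//; lra.
rewrite lerD2l ler_wpM2l//; last by lra.
by rewrite !mulr_ge0// invr_ge0 ltW.
Qed.

End AtGain.
End Bounds.

(** * The sublevel set and the constants *)

Lemma alpha_ge0 (F : realType) (sQ mu alpha : F) :
  0 < sQ -> 0 < mu -> sQ <= alpha / mu -> 0 <= alpha.
Proof.
move=> sQ0 mu0 sQp; have := le_trans (ltW sQ0) sQp.
by rewrite pmulr_lge0 ?invr_gt0.
Qed.

Section SublevelSet.
Variables (F : realType) (n m d : nat) (disp : measure_display).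
Variables (T : measurableType disp) (P : probability T F) (x0 : T -> 'cV[F]_n).
Hypothesis x0P : square_integrable P x0.
Variables (A : 'M[F]_n) (B : 'M[F]_(n, m)) (C : 'M[F]_(d, n)).
Variables (Q : 'M[F]_n) (R : 'M[F]_m) (sQ mu alpha : F).
Hypotheses (pQ : psd Q) (pR : psd R) (sQ0 : 0 < sQ) (mu0 : 0 < mu).
Hypothesis hQ : forall x, sQ * sqnorm x <= qform Q x.
Hypothesis hmu : forall x, mu * sqnorm x <= qform (second_moment P x0) x.
Local Opaque lyap cost_matrix dcost1 dcost2 dcost3.
Local Notation AK := (closed_loop A B C).
Local Notation X0 := (second_moment P x0).
Local Notation P0 := (cost_matrix A B C Q R).
Local Notation Ka := (sublevel A B C (cost A B C Q R P x0) alpha).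

Lemma sublevel_stable K : Ka K -> stable (AK K).
Proof. by case. Qed.

Lemma sublevel_trace K : Ka K -> \tr (P0 K *m X0) <= alpha.
Proof. by move=> [sK hJ]; rewrite -cost_trace. Qed.

Lemma sublevel_psd K : Ka K -> psd (P0 K).
Proof. by move=> /sublevel_stable sK; exact: (cost_psd sK pQ pR sQ0 hQ). Qed.

Lemma sublevel_cost_matrix K x : Ka K -> qform (P0 K) x <= alpha / mu * sqnorm x.
Proof.
move=> hK; have := moment_lower x0P x (sublevel_psd hK) (ltW mu0) hmu.
have := ler_wpM2r (sqnorm_ge0 x) (sublevel_trace hK) => h1 h2.
have := le_trans h2 h1; rewrite mulrC -ler_pdivlMr//.
by rewrite mulrAC.
Qed.

Lemma sublevel_closed_loop K x : Ka K ->
  norm2 (AK K *m x) <= Num.sqrt (alpha / mu / sQ) * norm2 x.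
Proof.
move=> hK; have sK := sublevel_stable hK.
have h1 := sublevel_cost_matrix x hK.
have h2 := qform_cost Q R sK x.
have h3 := weight_lower C K pR hQ (AK K *m x).
have h4 := weight_ge0 C K pR sQ0 hQ x.
have h5 : qform (cost_weight C Q R K) (AK K *m x) <= qform (P0 K) (AK K *m x).
  apply: (lyap_ge0 sK) => y; exact: (weight_ge0 C K pR sQ0 hQ).
have h6 : sqnorm (AK K *m x) <= alpha / mu / sQ * sqnorm x.
  rewrite mulrAC ler_pdivlMr// mulrC.
  by move: h1 h2 h3 h4 h5; lra.
have h7 : norm2 (AK K *m x) = Num.sqrt (sqnorm (AK K *m x)) by [].
rewrite h7; apply: le_trans (ler_wsqrtr h6) _.
have [a0|a0] := leP 0 (alpha / mu / sQ).
  by rewrite sqrtrM.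
have : alpha / mu / sQ * sqnorm x <= 0 by rewrite mulr_le0_ge0 ?sqnorm_ge0// ltW.
by move=> /ler0_sqrtr ->; rewrite mulr_ge0 ?sqrtr_ge0 ?norm2_ge0.
Qed.

Local Notation gamma := (gamma_cst A B C (cost A B C Q R P x0) alpha).

(** [gamma] is a supremum, so the uniform bound [sublevel_closed_loop] is needed
    before it bounds anything. *)
Lemma sublevel_gamma K : Ka K -> spectral_norm (AK K) <= gamma.
Proof.
move=> hK; apply: ub_le_sup; last by exists K.
exists (Num.sqrt (alpha / mu / sQ)) => _ [L hL <-].
apply: spectral_norm_le; first exact: sqrtr_ge0.
by move=> x; exact: sublevel_closed_loop.
Qed.

Lemma gamma_ge0 K : Ka K -> 0 <= gamma.
Proof. by move=> /sublevel_gamma; apply: le_trans; exact: spectral_norm_ge0. Qed.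

Lemma sublevel_lyap1 K : Ka K -> \tr (lyap (AK K) 1%:M *m X0) <= alpha / sQ.
Proof.
move=> hK; rewrite ler_pdivlMr// mulrC -mxtraceZ scalemxAl.
apply: le_trans (sublevel_trace hK); apply: (moment_le x0P) => x.
rewrite -lyapZ; apply: (lyap_le (sublevel_stable hK)) => y.
by rewrite qformZm qform1; exact: (weight_lower C K pR hQ).
Qed.

Lemma trace_dcost3_bound K nu Z eta E th D (q : F) : Ka K ->
  sQ <= alpha / mu ->
  3 / 4 * (spectral_norm C * Num.sqrt (spectral_norm R * (alpha / mu))) +
    1 / 2 * (spectral_norm C * spectral_norm B * (alpha / mu)) <=
    spectral_norm C * spectral_norm R * q ->
  0 <= nu -> contracts nu Z -> 0 <= eta -> contracts eta E ->
  0 <= th -> contracts th D ->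
  `|\tr (dcost3 A B C Q R K Z E D *m X0)| <=
    sens3 B C R (alpha / mu) gamma sQ q * (alpha / sQ) * th * (nu * eta).
Proof.
move=> hK sQp hq nu0 hZ eta0 hE th0 hD; have sK := sublevel_stable hK.
have g0 := gamma_ge0 hK.
have hg x : norm2 (AK K *m x) <= gamma * norm2 x.
  apply: le_trans (norm2_mul _ _) _.
  by rewrite ler_wpM2r ?norm2_ge0// sublevel_gamma.
have hp x := sublevel_cost_matrix x hK.
set c := nu * eta * th * sens3 B C R (alpha / mu) gamma sQ q.
have c0 : 0 <= c.
  by apply: mulr_ge0; [rewrite !mulr_ge0|exact: (sens3_ge0 sQ0 sQp g0 hq)].
have h x : `|qform (dcost3 A B C Q R K Z E D) x| <= qform (c *: lyap (AK K) 1%:M) x.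
  rewrite qformZm.
  exact: (dcost3_bound sK pQ pR sQ0 sQp hQ hp g0 hg hq x nu0 hZ eta0 hE th0 hD).
apply: le_trans (moment_norm_le x0P h) _.
rewrite -scalemxAl mxtraceZ.
have := ler_wpM2l c0 (sublevel_lyap1 hK) => /le_trans; apply.
by rewrite le_eqVlt; apply/orP; left; apply/eqP; rewrite /c; ring.
Qed.

Lemma hessian_lipschitz_sublevel K K' (q : F) :
  sQ <= alpha / mu ->
  3 / 4 * (spectral_norm C * Num.sqrt (spectral_norm R * (alpha / mu))) +
    1 / 2 * (spectral_norm C * spectral_norm B * (alpha / mu)) <=
    spectral_norm C * spectral_norm R * q ->
  (forall c, 0 <= c <= 1 -> Ka (K + c *: (K' - K))) ->
  spectral_norm (hessian (fun v => cost A B C Q R P x0 (unvec v)) (vec K)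
      - hessian (fun v => cost A B C Q R P x0 (unvec v)) (vec K')) <=
    sens3 B C R (alpha / mu) gamma sQ q * (alpha / sQ) * spectral_norm (K - K').
Proof.
move=> sQp hq seg; set th := spectral_norm (K - K').
have th0 : 0 <= th by exact: spectral_norm_ge0.
have hth : contracts th (K' - K).
  move=> x; have := norm2_mul (K - K') x.
  by rewrite -[K' - K]opprB mulNmx -[- (_ *m x)]scaleN1r norm2Z normrN normr1 mul1r.
have g0 : 0 <= gamma.
  have K0 : Ka (K + 0 *: (K' - K)) by apply: seg; rewrite lexx ler01.
  exact: gamma_ge0 K0.
have a0 := divr_ge0 (alpha_ge0 sQ0 mu0 sQp) (ltW sQ0).
have s0 : 0 <= sens3 B C R (alpha / mu) gamma sQ q := sens3_ge0 sQ0 sQp g0 hq.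
apply: (hessian_lipschitz_segment x0P pQ.1 pR.1).
- exact: mulr_ge0 (mulr_ge0 s0 a0) th0.
- by move=> c /seg /sublevel_stable.
move=> c x y /seg hc.
have hx : contracts (norm2 x) (unvec x : 'M[F]_(m, d)) by exact: norm2_unvec.
have hy : contracts (norm2 y) (unvec y : 'M[F]_(m, d)) by exact: norm2_unvec.
exact: (trace_dcost3_bound hc sQp hq (norm2_ge0 x) hx (norm2_ge0 y) hy th0 hth).
Qed.

End SublevelSet.

(** [sQ * sqnorm x <= qform P0 x <= alpha / mu * sqnorm x] at a nonzero [x]. *)
Lemma sublevel_alpha (F : realType) n m d (disp : measure_display)
    (T : measurableType disp) (P : probability T F) (x0 : T -> 'cV[F]_n.+1)
    (A : 'M[F]_n.+1) (B : 'M[F]_(n.+1, m)) (C : 'M[F]_(d, n.+1))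
    (Q : 'M[F]_n.+1) (R : 'M[F]_m) (sQ mu alpha : F) K :
  square_integrable P x0 -> psd Q -> psd R -> 0 < sQ -> 0 < mu ->
  (forall x, sQ * sqnorm x <= qform Q x) ->
  (forall x, mu * sqnorm x <= qform (second_moment P x0) x) ->
  sublevel A B C (cost A B C Q R P x0) alpha K -> sQ <= alpha / mu.
Proof.
move=> x0P pQ pR sQ0 mu0 hQ hmu hK.
have e0 : (delta_mx 0 0 : 'cV[F]_n.+1) != 0.
  apply/eqP => /(congr1 (fun v : 'cV[F]_n.+1 => v 0 0)) /eqP.
  by rewrite !mxE !eqxx oner_eq0.
rewrite -(ler_pM2r (sqnorm_gt0 e0)).
apply: le_trans (weight_lower C K pR hQ _) _.
apply: le_trans (sublevel_cost_matrix x0P pQ pR sQ0 mu0 hQ hmu _ hK).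
apply: (lyap_ge0 (sublevel_stable hK)) => y.
exact: (weight_ge0 C K pR sQ0 hQ).
Qed.

Section Constants.
Variable F : realType.

Lemma posdef_psd n (M : 'M[F]_n) : posdef M -> psd M.
Proof.
move=> [Ms Mp]; split=> // x; have [->|x0] := eqVneq x 0.
  by rewrite /qform /bform mulmx0 mxE.
exact: ltW (Mp x x0).
Qed.

Lemma sigma_min_gt0 n (M : 'M[F]_n.+1) : posdef M -> 0 < sigma_min M.
Proof.
move=> pM; have [_ [v v0 Mv]] := sigma_min_eigen (posdef_psd pM).
have := (pM.2 v v0); rewrite -mulmxA Mv -scalemxAr mxE.
have -> : (v^T *m v) 0 0 = sqnorm v by rewrite -qform1 /qform /bform mulmx1.
by rewrite pmulr_lgt0// sqnorm_gt0.
Qed.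

Lemma sigma_min_le_norm n (M : 'M[F]_n.+1) : psd M -> sigma_min M <= spectral_norm M.
Proof.
move=> pM; have [h [v v0 _]] := sigma_min_eigen pM.
rewrite -(ler_pM2r (sqnorm_gt0 v0)); apply: le_trans (h v) _.
exact: le_trans (ler_norm _) (qform_spectral _ _).
Qed.

Lemma sigma_min_dim0 (M : 'M[F]_0) : sigma_min M = 0.
Proof.
rewrite /sigma_min (_ : singular_values M = set0) ?inf0//.
apply/seteqP; split => // s [_ /eigenvalueP[v _]].
by rewrite thinmx0 eqxx.
Qed.

Lemma spectral_norm0 p q : spectral_norm (0 : 'M[F]_(p, q)) = 0.
Proof.
apply/le_anti; rewrite spectral_norm_ge0 andbT.
by apply: spectral_norm_le => // x; rewrite mul0mx norm20 mul0r.
Qed.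

(** Since [sigma_min R <= spectral_norm R], the first summand of [q3] times
    [spectral_norm R] is at least [sqrt (u ^+ 2 + v ^+ 2)] with
    [u = sqrt (spectral_norm R * alpha / mu)] and
    [v = spectral_norm B * alpha / mu].  The coefficients satisfy
    [(3 / 4) ^+ 2 + (1 / 2) ^+ 2 <= 1]; they are those that yield the factor
    [2 / 3] in [rhs1_bound2]. *)
Lemma q3_lower n m d (A : 'M[F]_n) (B : 'M[F]_(n, m)) (C : 'M[F]_(d, n))
    (R : 'M[F]_m) (alpha mu : F) :
  posdef R -> 0 < mu -> 0 <= alpha ->
  3 / 4 * (spectral_norm C * Num.sqrt (spectral_norm R * (alpha / mu))) +
    1 / 2 * (spectral_norm C * spectral_norm B * (alpha / mu)) <=
    spectral_norm C * spectral_norm R * q3 A B R alpha mu.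
Proof.
case: m B R => [|m] B R pR mu0 a0.
  (* Both sides vanish when there is no input. *)
  rewrite (thinmx0 R) (thinmx0 B) !spectral_norm0.
  by rewrite !(mul0r, mulr0) sqrtr0 !mulr0 addr0.
set c := spectral_norm C; set r := spectral_norm R; set b := spectral_norm B.
have c0 : 0 <= c by exact: spectral_norm_ge0.
have r0 : 0 <= r by exact: spectral_norm_ge0.
have b0 : 0 <= b by exact: spectral_norm_ge0.
have nA : 0 <= spectral_norm A by exact: spectral_norm_ge0.
set p := alpha / mu; have p0 : 0 <= p by rewrite divr_ge0// ltW.
have s0 := sigma_min_gt0 pR; have sr := sigma_min_le_norm (posdef_psd pR).
rewrite -/r in sr; set s := sigma_min R in s0 sr *.
pose w := Num.sqrt (r * p + b ^+ 2 * p ^+ 2).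
have hw : 3 / 4 * Num.sqrt (r * p) + 1 / 2 * (b * p) <= w.
  have rp : 0 <= r * p by rewrite mulr_ge0.
  have u0 := sqrtr_ge0 (r * p); have bp : 0 <= b * p by rewrite mulr_ge0.
  rewrite -ler_sqr ?nnegrE ?sqrtr_ge0 ?addr_ge0 ?mulr_ge0 ?invr_ge0 ?(ltW mu0)//.
  rewrite sqr_sqrtr; last by rewrite addr_ge0// mulr_ge0// sqr_ge0.
  rewrite -[X in _ <= X + _](sqr_sqrtr rp) -exprMn.
  move: u0 bp; set u := Num.sqrt _; set v := b * p => u0 v0.
  by have := sqr_ge0 (u - v); have := sqr_ge0 u; have := sqr_ge0 v; lra.
have hq : w <= r * q3 A B R alpha mu.
  rewrite /q3 -/r -/b -/s.
  have -> : Num.sqrt (r * alpha + b ^+ 2 * alpha ^+ 2 / mu) = Num.sqrt mu * w.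
    rewrite /w -sqrtrM ?(ltW mu0)//; congr Num.sqrt.
    by rewrite /p; field; rewrite gt_eqF.
  have sm : 0 < Num.sqrt mu by rewrite sqrtr_gt0.
  have -> : Num.sqrt mu * w / (Num.sqrt mu * s) = w / s.
    by field; rewrite !gt_eqF.
  rewrite mulrDr; apply: (@le_trans _ _ (r * (w / s))).
    by rewrite mulrCA ler_peMr ?sqrtr_ge0// ler_pdivlMr// mul1r.
  by rewrite lerDl !(mulr_ge0, invr_ge0)// ltW.
have := ler_wpM2l c0 (le_trans hw hq); rewrite [leRHS]mulrA.
apply: le_trans; rewrite le_eqVlt; apply/orP; left; apply/eqP; ring.
Qed.

Lemma sens3_lipschitz_cst n m d (A : 'M[F]_n) (B : 'M[F]_(n, m)) (C : 'M[F]_(d, n))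
    (Q : 'M[F]_n) (R : 'M[F]_m) (alpha mu gamma : F) :
  0 < sigma_min Q -> sigma_min Q <= alpha / mu -> 0 <= gamma -> 0 < mu ->
  posdef R ->
  sens3 B C R (alpha / mu) gamma (sigma_min Q) (q3 A B R alpha mu)
    * (alpha / sigma_min Q) <= hessian_lipschitz_cst A B C Q R alpha mu gamma.
Proof.
move=> sQ0 sQp g0 mu0 pR.
have a0 := alpha_ge0 sQ0 mu0 sQp.
have hq := q3_lower A B C pR mu0 a0.
have h := sens3_le sQ0 sQp g0 hq (erefl _) (erefl _).
apply: le_trans (ler_wpM2r (divr_ge0 a0 (ltW sQ0)) h) _.
rewrite /hessian_lipschitz_cst /zeta3 /zeta4 /zeta1 /zeta2.
move: sQ0 mu0 => {sQp a0 g0 hq h pR}.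
move: (q3 _ _ _ _ _) (spectral_norm B) (spectral_norm C) (spectral_norm R).
move: (sigma_min Q) => sQ q b c r sQ0 mu0.
by rewrite le_eqVlt; apply/orP; left; apply/eqP; field; rewrite !gt_eqF.
Qed.

End Constants.

(** * Lipschitz continuity of the Hessian *)

Theorem lemma8 (F : realType) (n m d : nat)
    (A : 'M[F]_n) (B : 'M[F]_(n, m)) (C : 'M[F]_(d, n))
    (Q : 'M[F]_n) (R : 'M[F]_m)
    (disp : measure_display) (T : measurableType disp) (P : probability T F)
    (x0 : T -> 'cV[F]_n) (Kstar : 'M[F]_(m, d)) (alpha : F) :
  row_free C -> posdef Q -> posdef R ->
  square_integrable P x0 ->
  let mu := sigma_min (second_moment P x0) in
  let J := cost A B C Q R P x0 in
  let Kalpha := sublevel A B C J alpha in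
  let gamma := gamma_cst A B C J alpha in
  let M := hessian_lipschitz_cst A B C Q R alpha mu gamma in
  let hessJ := hessian (fun v => J (unvec v)) in
  0 < mu ->
  feasible A B C Kstar ->
  (forall K, feasible A B C K -> J Kstar <= J K) ->
  J Kstar <= alpha ->
  forall K K' : 'M[F]_(m, d),
    Kalpha K -> Kalpha K' ->
    (forall delta : F, 0 <= delta <= 1 -> Kalpha (K + delta *: (K' - K))) ->
    spectral_norm (hessJ (vec K) - hessJ (vec K')) <= M * spectral_norm (K - K').
Proof.
case: n A B C Q x0 => [|n] A B C Q x0 _ pQ pR x0P mu J Ka gamma M hessJ mu0.
  (* In dimension [0] there are no singular values: [mu] is [inf set0], which is [0]. *)
  by move: mu0; rewrite /mu sigma_min_dim0 ltxx.
move=> _ _ _ K K' hK hK' seg.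
have [hmu _] := sigma_min_eigen (second_moment_psd x0P).
have [hQ _] := sigma_min_eigen (posdef_psd pQ).
have sQ0 := sigma_min_gt0 pQ.
have pQ' := posdef_psd pQ; have pR' := posdef_psd pR.
have sQp := sublevel_alpha x0P pQ' pR' sQ0 mu0 hQ hmu hK.
have g0 := gamma_ge0 x0P pQ' pR' sQ0 mu0 hQ hmu hK.
have a0 := alpha_ge0 sQ0 mu0 sQp.
have hq := q3_lower A B C pR mu0 a0.
apply: le_trans (hessian_lipschitz_sublevel x0P pQ' pR' sQ0 mu0 hQ hmu sQp hq seg) _.
apply: ler_wpM2r; first exact: spectral_norm_ge0.
exact: sens3_lipschitz_cst.
Qed.
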